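(* Let $(\lambda_n)_{n\ge 1}\subset(0,1)$ satisfy $\frac{n\lambda_n}{\log n}\to\infty$ and $\lambda_n=o\left(\frac{1}{\log n}\right)$ as $n\to\infty$. Let $f:[-1/2,1/2)\to\mathbb R$ be continuous with $\lim_{\nu\to 1/2}f(\nu)=f(-1/2)$ and $\operatorname{ess\,inf}_{\nu\in[-1/2,1/2)}f(\nu)>0$, and suppose that its Fourier coefficients $f_h=\int_{-1/2}^{1/2}f(u)e^{-2\pi i h u}\,du$ satisfy $|f_h|\le C(1+|h|)^{-(1+\kappa)}$ for all $h\in\mathbb Z$, with some constants $C>0$, $\kappa>0$. Let $\Sigma_n=(f_{j-i})_{1\le i,j\le n}$ be a covariance matrix for each $n\ge1$. Then the asymptotic minimax detection boundary for testing $$H_0: Y\sim\mathcal N_n(0,\Sigma_n)\quad\text{against}\quad H_1^n:\ \exists I\in\mathcal I(\lambda_n),\ \exists \delta\in\mathbb R,\ |\delta|\ge\Delta_n:\ Y\sim\mathcal N_n(\delta\mathbf 1_I,\Sigma_n)$$ is given by $$\Delta_n\asymp\sqrt{\frac{-2f(0)\log\lambda_n}{n\lambda_n}},\qquad n\to\infty .$$ That is, with $\varphi_n=\sqrt{\frac{-2f(0)\log\lambda_n}{n\lambda_n}}$, for every $\alpha\in(0,\tfrac12)$: (upper detection bound) there is a sequence of tests $(\Phi^*_{n,\alpha})_{n\in\mathbb N}$ of asymptotic level $\alpha$ such that for all $c>1$, $\limsup_{n\to\infty}\bar\beta(\Phi^*_{n,\alpha},\Sigma_n,c\varphi_n,\lambda_n)\le\alpha$;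 (lower detection bound) for all $0<c<1$ and every sequence of tests $(\Phi_n)_{n\in\mathbb N}$ of asymptotic level $\alpha$, $\liminf_{n\to\infty}\bar\beta(\Phi_n,\Sigma_n,c\varphi_n,\lambda_n)\ge1-\alpha$.
   Context: One observes $Y=(Y_{1,n},\dots,Y_{n,n})^T=\mu_n+\xi_n$, where $\xi_n\sim\mathcal N_n(0,\Sigma_n)$ consists of $n$ consecutive samples of a real stationary centered Gaussian process with (symmetric) autocovariance function $\gamma(h)=f_h$ and spectral density $f$, so that $\Sigma_n(i,j)=f_{|i-j|}$. The matrix $\Sigma_n$ and the length $\lambda_n$ are known. For an interval $I\subset[0,1]$, $\mathbf 1_I\in\mathbb R^n$ is the vector with entries $\mathbf 1_I(i)=1$ if $\frac in\in I$ and $\mathbf 1_I(i)=0$ otherwise, $1\le i\le n$. For $\lambda\in(0,1)$, $\mathcal I(\lambda)=\{[a,b): 0\le a<b\le1,\ b-a=\lambda\}$. A test is a (measurable) map $\Phi_n:\mathbb R^n\to\{0,1\}$. Let $\mathbb P_0$ and $\mathbb P_{I,\delta}$ denote the laws $\mathcal N_n(0,\Sigma_n)$ and $\mathcal N_n(\delta\mathbf 1_I,\Sigma_n)$ of $Y$. The type I error is $\bar\alpha(\Phi_n,\Sigma_n)=\mathbb P_0[\Phi_n(Y)=1]$; the sequence $(\Phi_n)$ has asymptotic level $\alpha$ if $\limsup_{n\to\infty}\bar\alpha(\Phi_n,\Sigma_n)\le\alpha$. The type II error is $\bar\beta(\Phi_n,\Sigma_n,\Delta_n,\lambda_n)=\sup_{I\in\mathcal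 I(\lambda_n)}\sup_{|\delta|\ge\Delta_n}\mathbb P_{I,\delta}[\Phi_n(Y)=0]$. For positive sequences, $a_n\asymp b_n$ means $a_n/b_n\to1$. *)

(* Defs.v *)
From HB Require Import structures.
From mathcomp Require Import all_boot all_order all_algebra.
From mathcomp Require Import complex.
From mathcomp Require Import all_classical all_reals all_analysis.
From mathcomp Require Import measurable_realfun ess_sup_inf.

Set Implicit Arguments.
Unset Strict Implicit.
Unset Printing Implicit Defensive.

Import Order.TTheory GRing.Theory Num.Theory.
Import numFieldNormedType.Exports.

Local Open Scope classical_set_scope.
Local Open Scope ring_scope.
Local Open Scope complex_scope.

Section gaussian_law.
Context {R : realType}.

Definition cons_pair n (p : measurableTypeR R * n.-tuple R) : n.+1.-tuple R :=
  [the n.+1.-tuple R of p.1 :: p.2].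

Lemma measurable_cons_pair n :
  measurable_fun [set: measurableTypeR R * n.-tuple R] (@cons_pair n).
Proof.
exact: (@measurable_cons _ _ _ R (fst : measurableTypeR R * n.-tuple R -> R)).
Qed.

HB.instance Definition _ n := isMeasurableFun.Build _ _ _ _ (@cons_pair n)
  (@measurable_cons_pair n).

(* The n-fold product of N(0,1), transported along R * R^n' = R^(n'+1). *)
Fixpoint std_gaussian n : probability (n.-tuple R) R :=
  match n return probability (n.-tuple R) R with
  | 0 => \d_ [tuple]
  | n'.+1 =>
      distribution (normal_prob (0 : R) (1 : R) \x std_gaussian n')%E
                   (@cons_pair n')
  end.

Definition affine_map n (m : 'cV[R]_n) (A : 'M[R]_n) (z : n.-tuple R) :
    n.-tuple R :=
  [tuple m i 0 + \sum_(j < n) A i j * tnth z j | i < n].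

Lemma measurable_affine_map n (m : 'cV[R]_n) (A : 'M[R]_n) :
  measurable_fun [set: n.-tuple R] (affine_map m A).
Proof.
apply/measurable_fun_tnthP => i.
rewrite (_ : _ \o _ = fun z : n.-tuple R =>
    m i 0 + \sum_(j < n) A i j * tnth z j); last first.
  by apply/funext => z; rewrite /= tnth_mktuple.
apply: measurable_funD => //.
apply: measurable_sum => j.
apply: measurable_funM => //.
exact: measurable_tnth.
Qed.

HB.instance Definition _ n (m : 'cV[R]_n) (A : 'M[R]_n) :=
  isMeasurableFun.Build _ _ _ _ (affine_map m A) (measurable_affine_map m A).

(* Some A with A A^T = S; one exists as soon as S is symmetric and positive
   semidefinite. *)
Definition mx_root n (S : 'M[R]_n) : 'M[R]_n :=
  xget 0 [set A : 'M[R]_n | A *m A^T = S].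

(* N_n(m, S), for S a covariance matrix, as the law of m + A Z, where A A^T = S
   and Z has n independent N(0,1) coordinates; this law does not depend on the
   choice of A. *)
Definition gaussian_law n (m : 'cV[R]_n) (S : 'M[R]_n) :
    probability (n.-tuple R) R :=
  distribution (std_gaussian n) (affine_map m (mx_root S)).

Definition is_covariance_mx n (S : 'M[R]_n) : Prop :=
  S^T = S /\ forall v : 'rV[R]_n, 0 <= (v *m S *m v^T) 0 0.

End gaussian_law.

Section spectral_density.
Context {R : realType}.

Definition freq_dom : set R := `[- 2^-1, 2^-1[.

Lemma measurable_freq_dom : measurable freq_dom.
Proof. exact: measurable_itv. Qed.

(* The integral of f(u) exp(-2 i pi h u), by real and imaginary parts. *)
Definition fourier_coef (f : R -> R) (h : int) : R[i] :=
  (\int[lebesgue_measure]_(u in freq_dom) (f u * cos (2 * pi * h%:~R * u)))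
  -i* (\int[lebesgue_measure]_(u in freq_dom) (f u * sin (2 * pi * h%:~R * u))).

Definition freq_ess_inf (f : R -> R) : \bar R :=
  ess_inf (mrestr lebesgue_measure measurable_freq_dom) (EFin \o f).

End spectral_density.

Section testing.
Context {R : realType}.

(* The design points are 1/n, ..., n/n, while ordinals start at 0. *)
Definition indic_vec n (I : set R) : 'cV[R]_n :=
  \col_(i < n) \1_I (i.+1%:R / n%:R).

Definition intervals (lambda : R) : set (set R) :=
  [set I | exists a b : R,
    [/\ 0 <= a, a < b, b <= 1, b - a = lambda & I = `[a, b[%classic]].

Definition test n := {mfun (n.-tuple R) >-> bool}.

Definition type1_error n (Phi : test n) (S : 'M[R]_n) : \bar R :=
  gaussian_law 0 S [set y | Phi y = true].

Definition type2_error n (Phi : test n) (S : 'M[R]_n) (Delta lambda : R) :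
    \bar R :=
  ereal_sup [set p | exists (I : set R) (delta : R),
    [/\ intervals lambda I, Delta <= `|delta| &
        p = gaussian_law (delta *: indic_vec n I) S [set y | Phi y = false]]].

Definition asymptotic_level (Phi : forall n, test n) (S : forall n, 'M[R]_n)
    (alpha : R) : Prop :=
  (limn_esup (fun n => type1_error (Phi n) (S n)) <= alpha%:E)%E.

Definition detection_rate (f : R -> R) (lambda : nat -> R) (n : nat) : R :=
  Num.sqrt (- 2 * f 0 * ln (lambda n) / (n%:R * lambda n)).

End testing.
Arguments test : clear implicits.

(* Main.v *)
From HB Require Import structures.
Require Import Defs.
From mathcomp Require Import all_boot all_order all_algebra.
From mathcomp Require Import complex.
From mathcomp Require Import all_classical all_reals all_analysis.
From mathcomp Require Import measurable_realfun ess_sup_inf.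
From mathcomp Require Import ring lra.

Import Order.TTheory GRing.Theory Num.Theory.
Import numFieldNormedType.Exports.

Set Implicit Arguments.
Unset Strict Implicit.
Unset Printing Implicit Defensive.

Local Open Scope classical_set_scope.
Local Open Scope ring_scope.

(** A quadratic form of the covariance matrix is an integral over frequencies:
    [v Sigma v^T] is the integral of [f |v^|^2], where [v^] is the trigonometric
    polynomial with coefficients [v].  The indicator of a block of consecutive
    indices lives near frequency 0: multiplied by [1 - exp(2 i pi u)] its
    polynomial telescopes to two end points, so its energy against the kernel
    [gap u = |1 - exp(2 i pi u)|^2], which vanishes only at 0, does not grow with
    the length of the block.  As [f] is continuous, bounded and bounded away
    from 0, one has [f <= c + B gap] for every [c > f 0] and
    [1/f <= 1/c + B gap] for every [0 < c < f 0].  Hence, on blocks of about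
    [n lambda_n] indices, the noise behaves as white noise of variance [f 0], in
    two senses: a block sum has variance at most [(1 + o(1)) f 0 n lambda_n]
    ([quad_indicator_le]), and on the span of disjoint blocks the inverse of
    [Sigma_n] is at most [(1 + o(1)) / f 0] ([quad_blocks_lower_bound]).

    Upper bound.  Let [L = - log lambda_n].  The test scans the sums over windows
    of length [n lambda_n] whose left ends form a grid of step [n lambda_n / L].
    There are about [L / lambda_n] windows, and the logarithm of this number is
    [L + O(log L)], so the union bound gives level [alpha] with a threshold
    of at most [(1 + o(1)) sqrt (2 f(0) n lambda_n L)] ([scan_test_type1]).  Some
    window covers the signal except for a fraction of order [1 / L], so a signal of height
    [c phi_n] with [c > 1] exceeds the threshold by many standard deviations
    ([scan_test_type2], [scan_slack]).

    Lower bound.  The prior is uniform on about [1 / lambda_n] disjoint blocks,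
    with the height [delta = c phi_n] where [c < 1].  In coordinates where the
    noise is standard Gaussian the signals are vectors whose Gram matrix is at
    most [T I] with [T = (1 + c) L < 2 L] ([whitened_gram_le]).  Additional
    independent Gaussian coordinates, which the test does not look at, make these
    vectors orthogonal with squared length [T] ([gram_completion]); the
    likelihood ratios are then uncorrelated.  When each of them is truncated
    where it is atypically large, their average has mean and second moment
    tending to 1 because [T < 2 L] ([mixture_test_bound]), so it tends to 1 in
    mean square and the mixture cannot be separated from the null hypothesis. *)

(** * Bilinear forms and square roots of covariance matrices *)

Section bilinear_forms.
Context {R : realType}.

Definition dot n (u v : 'I_n -> R) : R := \sum_i u i * v i.

Lemma dotC n (u v : 'I_n -> R) : dot u v = dot v u.
Proof. by apply: eq_bigr => i _; rewrite mulrC. Qed.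

Lemma dotDl n (u v w : 'I_n -> R) :
  dot (fun i => u i + v i) w = dot u w + dot v w.
Proof. by rewrite /dot -big_split; apply: eq_bigr => i _; rewrite mulrDl. Qed.

Lemma dotZl n c (u w : 'I_n -> R) : dot (fun i => c * u i) w = c * dot u w.
Proof. by rewrite /dot mulr_sumr; apply: eq_bigr => i _; rewrite mulrA. Qed.

Lemma dotZZ n c (u : 'I_n -> R) :
  dot (fun i => c * u i) (fun i => c * u i) = c ^+ 2 * dot u u.
Proof. by rewrite dotZl dotC dotZl mulrA. Qed.

Lemma dotDD n (u v : 'I_n -> R) :
  dot (fun i => u i + v i) (fun i => u i + v i) = dot u u + 2 * dot u v + dot v v.
Proof. by rewrite dotDl dotC dotDl [X in _ + X]dotC dotDl (dotC v u); ring. Qed.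

Lemma dotNl n (u v : 'I_n -> R) : dot (fun i => - u i) v = - dot u v.
Proof. by rewrite /dot -sumrN; apply: eq_bigr => i _; rewrite mulNr. Qed.

Definition quad n (S : 'M[R]_n) (v : 'I_n -> R) : R :=
  \sum_i \sum_j v i * v j * S i j.

Lemma quadN n (S : 'M[R]_n) (v : 'I_n -> R) : quad S (fun i => - v i) = quad S v.
Proof. by apply: eq_bigr => i _; apply: eq_bigr => j _; rewrite mulrNN. Qed.

Lemma quad_mulmx n (S : 'M[R]_n) (v : 'rV[R]_n) :
  (v *m S *m v^T) 0 0 = quad S (fun i => v 0 i).
Proof.
rewrite mxE /quad; under eq_bigr do rewrite !mxE mulr_suml.
rewrite exchange_big; apply: eq_bigr => i _; apply: eq_bigr => j _ /=; ring.
Qed.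

Definition mxform n (A : 'M[R]_n) (v : 'I_n -> R) (j : 'I_n) : R :=
  \sum_i v i * A i j.

Lemma dot_mxform n (A : 'M[R]_n) (v : 'I_n -> R) :
  dot (mxform A v) (mxform A v) = quad (A *m A^T) v.
Proof.
rewrite /dot /mxform /quad.
under eq_bigr do rewrite big_distrlr/=.
rewrite exchange_big; apply: eq_bigr => i _ /=.
rewrite exchange_big; apply: eq_bigr => j _ /=.
rewrite mxE mulr_sumr; apply: eq_bigr => k _; rewrite mxE; ring.
Qed.

End bilinear_forms.

Section cholesky.
Context {R : realType}.

(** Cholesky's algorithm.  A zero pivot forces the rest of its row to vanish, and
    a positive one is eliminated by passing to the Schur complement. *)
Lemma covariance_mx_root n (S : 'M[R]_n) :
  is_covariance_mx S -> exists A : 'M[R]_n, A *m A^T = S.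
Proof.
elim: n => [|n IH] in S *; first by move=> _; exists 0; apply/matrixP => -[].
rewrite -[n.+1]/(1 + n)%N in S *; move=> [Ssym Spsd].
pose a := S 0 0; pose b := ursubmx S; pose D := drsubmx S.
have dlE : dlsubmx S = b^T by rewrite -[in LHS]Ssym -trmx_ursub.
have DE : D^T = D by rewrite /D trmx_drsub Ssym.
have ulE : ulsubmx S = a%:M.
  by rewrite [ulsubmx S]mx11_scalar !mxE; congr ((S _ _)%:M); apply/val_inj.
have SE : S = block_mx a%:M b b^T D by rewrite -ulE -dlE submxK.
have quadE x (y : 'rV_n) : (row_mx x%:M y *m S *m (row_mx x%:M y)^T) 0 0 =
    x ^+ 2 * a + 2 * x * (b *m y^T) 0 0 + (y *m D *m y^T) 0 0.
  rewrite SE mul_row_block tr_row_mx mul_row_col tr_scalar_mx.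
  have -> : y *m b^T = b *m y^T.
    by rewrite [RHS]mx11_scalar -tr_scalar_mx -mx11_scalar trmx_mul trmxK.
  rewrite !mulmxDl -(mulmxA _ b) [b *m y^T]mx11_scalar -!scalar_mxM.
  rewrite !(mxE, mulr1n, eqxx) /=; ring.
have a0 : 0 <= a.
  have := Spsd (row_mx 1%:M 0).
  by rewrite quadE trmx0 mulmx0 mul0mx mulmx0 !mxE expr1n mul1r mulr0 !addr0.
have Dpsd (y : 'rV_n) : 0 <= (y *m D *m y^T) 0 0.
  have := Spsd (row_mx 0%:M y).
  by rewrite quadE expr0n/= !(mul0r, mulr0, add0r).
have [a_eq0|a_neq0] := eqVneq a 0.
  (* the form is affine in x, hence constant *)
  (* The form is affine in the pivot coordinate.  If its slope did not vanish, the
     value chosen below for this coordinate would make the form equal to -1. *)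
  have b0 : b = 0.
    apply/rowP => j; rewrite [RHS]mxE.
    pose y : 'rV[R]_n := delta_mx 0 j; pose d := (y *m D *m y^T) 0 0.
    have byE : (b *m y^T) 0 0 = b 0 j.
      rewrite mxE (bigD1 j)//= big1 ?addr0; first by rewrite !mxE !eqxx mulr1.
      by move=> i /negbTE ij; rewrite !mxE ij andbF mulr0.
    apply/eqP/negP => /negP bj0.
    have := Spsd (row_mx (- (d + 1) / (2 * b 0 j))%:M y).
    rewrite quadE a_eq0 mulr0 add0r byE -/d.
    have -> : 2 * (- (d + 1) / (2 * b 0 j)) * b 0 j + d = - 1 by field.
    by rewrite oppr_ge0 ler10.
  have [A AE] := IH D (conj DE Dpsd).
  exists (block_mx 0 0 0 A).
  by rewrite tr_block_mx mulmx_block !trmx0 !(mulmx0, mul0mx) !add0r AE SE a_eq0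
    b0 trmx0 raddf0.
have a_gt0 : 0 < a by rewrite lt_neqAle eq_sym a_neq0.
pose E := D - a^-1 *: (b^T *m b).
have Esym : E^T = E.
  by rewrite /E linearB/= DE linearZ/= trmx_mul trmxK.
have Epsd (y : 'rV_n) : 0 <= (y *m E *m y^T) 0 0.
  pose beta := (b *m y^T) 0 0.
  have := Spsd (row_mx (- beta / a)%:M y); rewrite quadE -/beta.
  rewrite /E mulmxBr mulmxBl -scalemxAr -scalemxAl.
  have -> : y *m (b^T *m b) *m y^T = (beta ^+ 2)%:M.
    rewrite mulmxA -mulmxA.
    have -> : y *m b^T = b *m y^T.
      by rewrite [RHS]mx11_scalar -tr_scalar_mx -mx11_scalar trmx_mul trmxK.
    by rewrite [b *m y^T]mx11_scalar -scalar_mxM expr2.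
  set d := (y *m D *m y^T) 0 0.
  have -> : (y *m D *m y^T - a^-1 *: (beta ^+ 2)%:M) 0 0 = d - a^-1 * beta ^+ 2.
    by rewrite mxE [X in _ + X]mxE [X in - X]mxE [X in _ * X]mxE mulr1n.
  by congr (0 <= _); field.
have [A AE] := IH E (conj Esym Epsd).
pose r := Num.sqrt a.
have r0 : r != 0 by rewrite gt_eqF// sqrtr_gt0.
have rr : r * r = a by rewrite -expr2 sqr_sqrtr.
exists (block_mx r%:M 0 (r^-1 *: b^T) A).
rewrite tr_block_mx mulmx_block !trmx0 !(mulmx0, mul0mx) !addr0 tr_scalar_mx.
rewrite -scalar_mxM rr linearZ/= trmxK AE SE; congr block_mx.
- by rewrite mul_scalar_mx scalerA divff// scale1r.
- by rewrite mul_mx_scalar scalerA divff// scale1r.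
- rewrite -scalemxAl -scalemxAr scalerA -invfM rr /E.
  by rewrite addrC subrK.
Qed.

Lemma mx_rootP n (S : 'M[R]_n) :
  is_covariance_mx S -> mx_root S *m (mx_root S)^T = S.
Proof. by move=> /covariance_mx_root AE; apply: (xgetPex 0 AE). Qed.

Lemma quad_ge0 n (S : 'M[R]_n) (v : 'I_n -> R) : is_covariance_mx S -> 0 <= quad S v.
Proof.
move=> cS; rewrite -(mx_rootP cS) -dot_mxform.
by apply: sumr_ge0 => i _; rewrite -expr2 sqr_ge0.
Qed.

End cholesky.

(** * The standard Gaussian law *)

Section gaussian.
Context {R : realType}.
Local Notation leb := (@lebesgue_measure R).

Lemma ge0_integral_translation (c : R) (g : R -> \bar R) :
  measurable_fun setT g -> (forall x, 0 <= g x)%E ->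
  (\int[leb]_x g (x + c)%R = \int[leb]_x g x)%E.
Proof.
move=> mg g0.
have mshift : measurable_fun setT
    ((fun x : R => x + c)%R : measurableTypeR R -> measurableTypeR R).
  by apply: measurable_funD.
transitivity (\int[pushforward leb
    ((fun x : R => x + c)%R : measurableTypeR R -> measurableTypeR R)]_x g x)%E.
  by rewrite ge0_integral_pushforward.
apply: eq_measure_integral => A mA _; apply/esym.
apply: lebesgue_measure_unique => //= _ [[a b]] _ <-.
rewrite /pushforward.
have -> : (fun x : R => x + c) @^-1` `]a, b] = `]a - c, b - c]%classic.
  by apply/seteqP; split => x /=; rewrite !in_itv/= ltrBlDr lerBrDr.
rewrite !lebesgue_measure_itv/= !lte_fin ltrD2r.
by case: ifP => // _; rewrite -!EFinB; congr EFin; rewrite opprB addrA subrK.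
Qed.

(** The Gaussian density agrees almost everywhere with the Radon-Nikodym
    derivative, since both have the same integrals over measurable sets. *)
Lemma ge0_integral_normal_prob (m s : R) (g : R -> \bar R) :
  measurable_fun setT g -> (forall x, 0 <= g x)%E ->
  (\int[normal_prob m s]_x g x = \int[leb]_x (g x * (normal_pdf m s x)%:E))%E.
Proof.
move=> mg g0.
have dom := normal_prob_dominates m s.
rewrite -(Radon_Nikodym_SigmaFinite.change_of_variables dom)//.
have mRN := measurable_int _ (Radon_Nikodym_SigmaFinite.f_integrable dom).
have mpdf : measurable_fun setT (fun x => (normal_pdf m s x)%:E).
  by apply/measurable_EFinP; exact: measurable_normal_pdf.
apply: ae_eq_integral => //.
- exact: emeasurable_funM.
- exact: emeasurable_funM.
- apply: ae_eqe_mul2l; apply: integral_ae_eq => //.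
    exact: Radon_Nikodym_SigmaFinite.f_integrable.
  by move=> A _ mA; rewrite -Radon_Nikodym_SigmaFinite.f_integral.
Qed.

Lemma ge0_integral_normal_shift (c : R) (g : R -> \bar R) :
  measurable_fun setT g -> (forall x, 0 <= g x)%E ->
  (\int[normal_prob 0 1]_x g (x + c)%R =
   \int[normal_prob 0 1]_x (g x * (expR (c * x - c ^+ 2 / 2))%:E))%E.
Proof.
move=> mg g0.
have mshift : measurable_fun setT (fun x : R => x + c).
  by apply: measurable_funD.
have mexp : measurable_fun setT (fun x : R => (expR (c * x - c ^+ 2 / 2))%:E).
  apply/measurable_EFinP; apply: measurableT_comp => //.
  by apply: measurable_funB => //; apply: measurable_funM.
rewrite !ge0_integral_normal_prob//; first last.
- exact: measurableT_comp.
- by move=> x; rewrite mule_ge0// lee_fin expR_ge0.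
- exact: emeasurable_funM.
rewrite -[RHS](@ge0_integral_translation c); first last.
- move=> x; rewrite !mule_ge0// lee_fin ?expR_ge0//.
  exact: normal_pdf_ge0.
- apply: emeasurable_funM; first exact: emeasurable_funM.
  by apply/measurable_EFinP; exact: measurable_normal_pdf.
apply: eq_integral => x _; rewrite -muleA -EFinM; congr (_ * _%:E)%E.
rewrite /normal_pdf oner_eq0 /normal_fun mulrCA -expRD.
by congr (_ * expR _); rewrite !subr0 expr1n; field.
Qed.

Lemma measurable_dot n (u : 'I_n -> R) :
  measurable_fun setT (fun z : n.-tuple R => dot u (tnth z)).
Proof.
apply: measurable_sum => j; apply: measurable_funM => //.
exact: measurable_tnth.
Qed.

Definition shift_tuple n (u : 'I_n -> R) (z : n.-tuple R) : n.-tuple R :=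
  [tuple tnth z i + u i | i < n].

Lemma measurable_shift_tuple n (u : 'I_n -> R) :
  measurable_fun setT (shift_tuple u).
Proof.
apply/measurable_fun_tnthP => i.
rewrite (_ : _ \o _ = fun z : n.-tuple R => tnth z i + u i).
  by apply: measurable_funD => //; exact: measurable_tnth.
by apply/funext => z /=; rewrite tnth_mktuple.
Qed.

(** The density, with respect to the standard Gaussian law, of its translate by
    [u]. *)
Definition tilt n (u : 'I_n -> R) (z : n.-tuple R) : R :=
  expR (dot u (tnth z) - dot u u / 2).

Lemma measurable_tilt n (u : 'I_n -> R) : measurable_fun setT (tilt u).
Proof.
apply: measurableT_comp => //; apply: measurable_funB => //.
exact: measurable_dot.
Qed.

Lemma ge0_integral_std_gaussianS n (g : n.+1.-tuple R -> \bar R) :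
  measurable_fun setT g -> (forall z, 0 <= g z)%E ->
  (\int[std_gaussian n.+1]_z g z =
   \int[normal_prob (0 : R) 1]_x \int[std_gaussian n]_t
     g (cons_pair (x, t)))%E.
Proof.
move=> mg g0.
rewrite /= ge0_integral_distribution//.
by rewrite fubini_tonelli1//=; apply: measurableT_comp.
Qed.

Lemma shift_tuple_cons n (u : 'I_n.+1 -> R) x (t : n.-tuple R) :
  shift_tuple u (cons_pair (x, t)) =
  cons_pair (x + u ord0, shift_tuple (u \o lift ord0) t).
Proof.
apply: eq_from_tnth => i; rewrite tnth_mktuple.
case: (unliftP ord0 i) => [j|] -> /=; last by rewrite !tnth0.
by rewrite /cons_pair/= !tnthS tnth_mktuple.
Qed.

Lemma tilt_cons n (u : 'I_n.+1 -> R) x (t : n.-tuple R) :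
  tilt u (cons_pair (x, t)) =
  expR (u ord0 * x - u ord0 ^+ 2 / 2) * tilt (u \o lift ord0) t.
Proof.
rewrite /tilt -expRD /dot !big_ord_recl/= tnth0; congr expR.
under eq_bigr do rewrite tnthS /=.
rewrite expr2 /=; set a := \sum_(i < n) _; set b := \sum_(i < n) _.
lra.
Qed.

(** The Cameron-Martin formula, by induction on the dimension: the first
    coordinate is handled by translation invariance of Lebesgue measure, and both
    the translation and the density factor over the coordinates. *)
Lemma ge0_integral_std_gaussian_shift n (u : 'I_n -> R)
    (g : n.-tuple R -> \bar R) :
  measurable_fun setT g -> (forall z, 0 <= g z)%E ->
  (\int[std_gaussian n]_z g (shift_tuple u z) =
   \int[std_gaussian n]_z (g z * (tilt u z)%:E))%E.
Proof.
elim: n => [|n IH] in u g *; move=> mg g0.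
  apply: eq_integral => z _; rewrite /tilt /dot !big_ord0 mul0r subr0 expR0 mule1.
  by congr g; apply: eq_from_tnth; case.
have mtilt : measurable_fun setT (fun z => (tilt u z)%:E).
  by apply/measurable_EFinP; exact: measurable_tilt.
have mcons x : measurable_fun setT
   (fun t : n.-tuple R => cons_pair (x, t)).
  by apply: measurableT_comp; [exact: measurable_cons_pair|exact: measurable_pair1].
have mgu : measurable_fun setT (fun z => g (shift_tuple u z)).
  exact: measurableT_comp mg (measurable_shift_tuple u).
have mgt : measurable_fun setT (fun z => (g z * (tilt u z)%:E)%E).
  exact: emeasurable_funM.
have gt0 z : (0 <= g z * (tilt u z)%:E)%E by rewrite mule_ge0// lee_fin expR_ge0.
rewrite (ge0_integral_std_gaussianS mgu (fun z => g0 _)).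
rewrite (ge0_integral_std_gaussianS mgt gt0).
pose u' := u \o lift ord0.
have mtilt' : measurable_fun setT (fun z => (tilt u' z)%:E).
  by apply/measurable_EFinP; exact: measurable_tilt.
pose G x := (\int[std_gaussian n]_t (g (cons_pair (x, t)) * (tilt u' t)%:E))%E.
have g'0 z : (0 <= g (cons_pair z) * (tilt u' z.2)%:E)%E.
  by rewrite mule_ge0// lee_fin expR_ge0.
have mG : measurable_fun setT G.
  apply: (measurable_fun_fubini_tonelli_F (fun z : measurableTypeR R * _ =>
    g (cons_pair z) * (tilt u' z.2)%:E)%E) => //.
  apply: emeasurable_funM; apply: measurableT_comp => //.
  exact: (measurableT_comp (measurable_tilt u')).

transitivity (\int[normal_prob (0 : R) 1]_x G (x + u ord0)%R)%E.
  apply: eq_integral => x _.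
  under eq_integral do rewrite shift_tuple_cons.
  rewrite (IH u' (fun t => g (cons_pair (x + u ord0, t))))//.
  by apply: measurableT_comp => //.
have G0 x : (0 <= G x)%E by apply: integral_ge0 => t _; exact: (g'0 (x, t)).
apply: (etrans (ge0_integral_normal_shift (u ord0) mG G0)).
apply: eq_integral => x _.
have mgx : measurable_fun setT
    (fun t => (g (cons_pair (x, t)) * (tilt u' t)%:E)%E).
  by apply: emeasurable_funM => //; exact: measurableT_comp mg (mcons x).
have gx0 t : [set: n.-tuple R] t -> (0 <= g (cons_pair (x, t)) * (tilt u' t)%:E)%E.
  by move=> _; exact: (g'0 (x, t)).
rewrite -(ge0_integralZr _ measurableT mgx gx0); last by rewrite lee_fin expR_ge0.
apply: eq_integral => t _.
by rewrite tilt_cons EFinM -muleA [(_%:E * _%:E)%E in LHS]muleC.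
Qed.

Lemma integral_tilt n (u : 'I_n -> R) :
  (\int[std_gaussian n]_z (tilt u z)%:E = 1)%E.
Proof.
transitivity (\int[std_gaussian n]_z (cst 1 z * (tilt u z)%:E))%E.
  by apply: eq_integral => z _; rewrite mul1e.
rewrite -(@ge0_integral_std_gaussian_shift n u (cst 1%E))//.
by rewrite integral_cst// mul1e; apply: probability_setT.
Qed.

Lemma integral_exp_dot n (u : 'I_n -> R) (b : R) :
  (\int[std_gaussian n]_z (expR (dot u (tnth z) + b))%:E =
   (expR (dot u u / 2 + b))%:E)%E.
Proof.
under eq_integral => z _.
  rewrite (_ : _ + b = (dot u u / 2 + b) + (dot u (tnth z) - dot u u / 2)); last lra.
  rewrite expRD EFinM; over.
rewrite ge0_integralZl// ?lee_fin ?expR_ge0//.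
  by rewrite integral_tilt mule1.
by apply/measurable_EFinP; exact: measurable_tilt.
Qed.

(** Chernoff's bound: the indicator is at most the exponential of
    [t / s * dot u z - t ^+ 2 / s]. *)
Lemma std_gaussian_tail n (u : 'I_n -> R) (s t : R) :
  0 < s -> dot u u <= s -> 0 <= t ->
  (std_gaussian n [set z | (t <= dot u (tnth z))%R] <=
   (expR (- (t ^+ 2 / (2 * s))))%:E)%E.
Proof.
move=> s0 us t0.
pose v i := t / s * u i.
have dv (w : 'I_n -> R) : dot v w = t / s * dot u w.
  by rewrite /dot mulr_sumr; apply: eq_bigr => i _; rewrite mulrA.
have dvv : dot v v = (t / s) ^+ 2 * dot u u.
  by rewrite dv /dot !mulr_sumr; apply: eq_bigr => i _; rewrite /v; ring.
have mE : measurable_fun setT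
    (fun z : n.-tuple R => (expR (dot v (tnth z) - t ^+ 2 / s))%:E).
  apply/measurable_EFinP; apply: measurableT_comp => //.
  by apply: measurable_funB => //; exact: measurable_dot.
have mA : measurable [set z : n.-tuple R | (t <= dot u (tnth z))%R].
  rewrite (_ : [set _ | _] =
    (fun z : n.-tuple R => dot u (tnth z)) @^-1` `[t, +oo[%classic).
    by rewrite -[_ @^-1` _]setTI; apply: measurable_dot.
  by apply/seteqP; split => z /=; rewrite in_itv/= andbT.
apply: (@le_trans _ _
  (\int[std_gaussian n]_z (expR (dot v (tnth z) - t ^+ 2 / s))%:E)%E); last first.
  rewrite integral_exp_dot lee_fin ler_expR dvv.
  have -> : - (t ^+ 2 / (2 * s)) = (t / s) ^+ 2 * s / 2 - t ^+ 2 / s.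
    by field; rewrite gt_eqF.
  by rewrite lerD2r ler_pM2r ?invr_gt0 ?ltr0n// ler_wpM2l// sqr_ge0.
rewrite -[X in std_gaussian n X]setIT -integral_indic//.
apply: ge0_le_integral => //.
  exact/measurable_EFinP/measurable_indic.
move=> z _; rewrite lee_fin indicE; case: (boolP (z \in _)) => [|_]; last exact: expR_ge0.
rewrite inE/= => tz; rewrite -(@expR0 R) ler_expR subr_ge0 dv expr2 mulrAC.
by apply: ler_wpM2l; rewrite // divr_ge0// ltW.
Qed.

End gaussian.

(** * Integration over the frequency interval *)

Section sums_of_integrals.
Context {R : realType}.

Lemma Rintegral_sum d (T : measurableType d) (mu : {measure set T -> \bar R})
    (A : set T) (I : Type) (s : seq I) (g : I -> T -> R) :
  measurable A -> (forall i, mu.-integrable A (EFin \o g i)) ->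
  mu.-integrable A (EFin \o (fun x => \sum_(i <- s) g i x)) /\
  \int[mu]_(x in A) (\sum_(i <- s) g i x) = \sum_(i <- s) \int[mu]_(x in A) g i x.
Proof.
move=> mA ig; elim: s => [|i s [IH1 IH2]].
  rewrite big_nil; split.
    apply: eq_integrable (integrable0 mu A) => // x _ /=; by rewrite big_nil.
  under eq_Rintegral do rewrite big_nil.
  by rewrite Rintegral_cst// mul0r.
pose h x : R := \sum_(j <- s) g j x.
split.
  have -> : EFin \o (fun x => \sum_(j <- i :: s) g j x) =
      ((EFin \o g i) \+ (EFin \o h))%E.
    by apply/funext => x /=; rewrite big_cons EFinD.
  exact: integrableD.
under eq_Rintegral do rewrite big_cons.
by rewrite RintegralD// big_cons IH2.
Qed.

Lemma integrable_sumr d (T : measurableType d) (mu : {measure set T -> \bar R})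
    (A : set T) (I : Type) (s : seq I) (g : I -> T -> R) :
  measurable A -> (forall i, mu.-integrable A (EFin \o g i)) ->
  mu.-integrable A (EFin \o (fun x => \sum_(i <- s) g i x)).
Proof. by move=> mA ig; have [] := Rintegral_sum s mA ig. Qed.

End sums_of_integrals.

Section frequency_integral.
Context {R : realType}.
Local Notation leb := (@lebesgue_measure R).
Local Notation D := (@freq_dom R).

(** These functions form an algebra of integrable functions that contains the
    spectral density and the trigonometric polynomials. *)
Definition bounded_mfun (g : R -> R) : Prop :=
  measurable_fun D g /\ exists M, forall u, D u -> `|g u| <= M.

Definition freq_int (g : R -> R) : R := \int[leb]_(u in D) g u.

Lemma freq_dom_measure : leb D = 1%E.
Proof.
have h : - 2^-1 < 2^-1 :> R by lra.
by rewrite /freq_dom lebesgue_measure_itv/= lte_fin h -EFinB; congr EFin; lra.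
Qed.

Lemma bounded_mfun_integrable g :
  bounded_mfun g -> leb.-integrable D (EFin \o g).
Proof.
move=> [mg [M gM]]; apply: measurable_bounded_integrable => //.
- exact: measurable_freq_dom.
- by rewrite (le_lt_trans (_ : leb D <= 1)%E) ?ltry// freq_dom_measure.
- exists M; split; first exact: num_real.
  by move=> x Mx u Du /=; apply: (le_trans (gM _ Du)); exact: ltW.
Qed.

Lemma bounded_mfun_cst c : bounded_mfun (fun=> c).
Proof. by split; [exact: measurable_cst|exists `|c|]. Qed.

Lemma bounded_mfunD g h :
  bounded_mfun g -> bounded_mfun h -> bounded_mfun (fun u => g u + h u).
Proof.
move=> [mg [M gM]] [mh [M' hM]]; split; first exact: measurable_funD.
exists (M + M') => u Du; apply: (le_trans (ler_normD _ _)).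
by apply: lerD; [exact: gM|exact: hM].
Qed.

Lemma bounded_mfunM g h :
  bounded_mfun g -> bounded_mfun h -> bounded_mfun (fun u => g u * h u).
Proof.
move=> [mg [M gM]] [mh [M' hM]]; split; first exact: measurable_funM.
exists (M * M') => u Du; rewrite normrM.
by apply: ler_pM => //; [exact: gM|exact: hM].
Qed.

Lemma bounded_mfunB g h :
  bounded_mfun g -> bounded_mfun h -> bounded_mfun (fun u => g u - h u).
Proof.
move=> bg bh; under eq_fun do rewrite -mulN1r.
by apply: bounded_mfunD => //; apply: bounded_mfunM => //; exact: bounded_mfun_cst.
Qed.

Lemma bounded_mfun_sum (I : finType) (g : I -> R -> R) :
  (forall i, bounded_mfun (g i)) -> bounded_mfun (fun u => \sum_i g i u).
Proof.
move=> bg; elim: (index_enum I) => [|i s IH].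
  by under eq_fun do rewrite big_nil; exact: bounded_mfun_cst.
by under eq_fun do rewrite big_cons; exact: bounded_mfunD.
Qed.

Lemma bounded_mfun_cos (a : R) : bounded_mfun (fun u => cos (a * u)).
Proof.
split; last by exists 1 => u _; exact: cos_max.
apply: measurable_funTS; apply: measurableT_comp; last exact: measurable_funM.
by apply: continuous_measurable_fun; exact: continuous_cos.
Qed.

Lemma bounded_mfun_sin (a : R) : bounded_mfun (fun u => sin (a * u)).
Proof.
split; last by exists 1 => u _; exact: sin_max.
apply: measurable_funTS; apply: measurableT_comp; last exact: measurable_funM.
by apply: continuous_measurable_fun; exact: continuous_sin.
Qed.

Lemma freq_intD g h : bounded_mfun g -> bounded_mfun h ->
  freq_int (fun u => g u + h u) = freq_int g + freq_int h.
Proof.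
move=> bg bh; apply: RintegralD; first exact: measurable_freq_dom.
- exact: bounded_mfun_integrable.
- exact: bounded_mfun_integrable.
Qed.

Lemma freq_intZ c g : bounded_mfun g ->
  freq_int (fun u => c * g u) = c * freq_int g.
Proof.
move=> bg; apply: RintegralZl; first exact: measurable_freq_dom.
exact: bounded_mfun_integrable.
Qed.

Lemma freq_intB g h : bounded_mfun g -> bounded_mfun h ->
  freq_int (fun u => g u - h u) = freq_int g - freq_int h.
Proof.
move=> bg bh; apply: RintegralB; first exact: measurable_freq_dom.
- exact: bounded_mfun_integrable.
- exact: bounded_mfun_integrable.
Qed.

Lemma freq_int_sum (I : finType) (g : I -> R -> R) :
  (forall i, bounded_mfun (g i)) ->
  freq_int (fun u => \sum_i g i u) = \sum_i freq_int (g i).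
Proof.
move=> bg; have ig i := bounded_mfun_integrable (bg i).
by refine (Rintegral_sum _ _ ig).2; exact: measurable_freq_dom.
Qed.

Lemma le_freq_int g h : bounded_mfun g -> bounded_mfun h ->
  (forall u, D u -> g u <= h u) -> freq_int g <= freq_int h.
Proof.
move=> bg bh gh; apply: (@le_Rintegral _ _ _ leb D g h) => //.
- exact: measurable_freq_dom.
- exact: bounded_mfun_integrable.
- exact: bounded_mfun_integrable.
Qed.

Lemma freq_int_cst c : freq_int (fun=> c) = c.
Proof.
rewrite /freq_int Rintegral_cst; last exact: measurable_freq_dom.
by have := freq_dom_measure => /= ->; rewrite mulr1.
Qed.

Lemma sin_pi_nat n : sin (pi * n%:R : R) = 0.
Proof.
elim: n => [|n IH]; first by rewrite mulr0 sin0.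
by rewrite -natr1 mulrDr mulr1 sinDpi IH oppr0.
Qed.

Lemma sin_pi_int (h : int) : sin (pi * h%:~R : R) = 0.
Proof.
case: h => n; first exact: sin_pi_nat.
by rewrite NegzE mulrNz mulrN sinN sin_pi_nat oppr0.
Qed.

Lemma freq_int_cos (h : int) :
  freq_int (fun u => cos (2 * pi * h%:~R * u)) = (h == 0)%:R.
Proof.
have [->|h0] := eqVneq h 0.
  rewrite (_ : (fun _ => _) = cst 1) ?freq_int_cst//.
  by apply/funext => u; rewrite mulr0 mul0r cos0.
pose a : R := 2 * pi * h%:~R.
have a0 : a != 0 by rewrite !mulf_neq0// ?intr_eq0// gt_eqF// pi_gt0.
rewrite /freq_int /freq_dom Rintegral_itv_bndo_bndc; last first.
  exact: bounded_mfun_integrable (bounded_mfun_cos a).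
pose F u := sin (a * u) / a.
have dF (u : R) : is_derive u 1 F (cos (a * u)).
  have -> : F = a^-1 \*: (sin \o (a \*: id)).
    by apply/funext => x; rewrite /F mulrC.
  apply: is_derive_eq.
  by rewrite /GRing.scale/= mulr1 mulrA mulrAC mulVf// mul1r.
have cF : continuous F.
  by move=> u; apply: differentiable_continuous; apply/derivable1_diffP; case: (dF u).
rewrite /Rintegral (@continuous_FTC2 _ _ F).
- rewrite -EFinB/= /F -mulrBl /a.
  have -> : 2 * pi * h%:~R * 2^-1 = pi * h%:~R :> R by field.
  have -> : 2 * pi * h%:~R * - 2^-1 = - (pi * h%:~R) :> R by field.
  by rewrite sinN sin_pi_int oppr0 subrr mul0r.
- lra.
- apply: continuous_subspaceT => u.
  apply: continuous_comp; first exact: mulrl_continuous.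
  exact: continuous_cos.
- split.
  + by move=> x _; case: (dF x).
  + exact/cvg_at_right_filter/cF.
  + exact/cvg_at_left_filter/cF.
- by move=> x _; rewrite derive1E; apply: derive_val.
Qed.

End frequency_integral.

(** * Trigonometric polynomials *)

Section trigonometric_polynomials.
Context {R : realType}.
Local Notation D := (@freq_dom R).

Definition cosw (a u : R) : R := cos (2 * pi * a * u).
Definition sinw (a u : R) : R := sin (2 * pi * a * u).

Lemma cosw_sub (a b u : R) :
  cosw a u * cosw b u + sinw a u * sinw b u = cosw (b - a) u.
Proof.
by rewrite /cosw mulrBr mulrBl cosB [cos _ * _]mulrC [sin _ * _]mulrC.
Qed.

Lemma coswS (a u : R) : cosw (a + 1) u = cosw 1 u * cosw a u - sinw 1 u * sinw a u.
Proof. by rewrite /cosw /sinw mulrDr mulrDl cosD mulrC [sin _ * _]mulrC. Qed.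

Lemma sinwS (a u : R) : sinw (a + 1) u = cosw 1 u * sinw a u + sinw 1 u * cosw a u.
Proof. by rewrite /cosw /sinw mulrDr mulrDl sinD mulrC [cos _ * _]mulrC. Qed.

Lemma cosw2Dsinw2 (a u : R) : cosw a u ^+ 2 + sinw a u ^+ 2 = 1.
Proof. exact: cos2Dsin2. Qed.

Lemma bounded_mfun_cosw a : bounded_mfun (cosw a).
Proof. exact: bounded_mfun_cos. Qed.

Lemma bounded_mfun_sinw a : bounded_mfun (sinw a).
Proof. exact: bounded_mfun_sin. Qed.

Definition tcos (I : finType) (x p : I -> R) (u : R) := \sum_i x i * cosw (p i) u.
Definition tsin (I : finType) (x p : I -> R) (u : R) := \sum_i x i * sinw (p i) u.

(** The real part of the product of the trigonometric polynomial with
    coefficients [x] and frequencies [p] by the conjugate of the one with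
    coefficients [y] and frequencies [q]. *)
Definition tdot (I J : finType) (x p : I -> R) (y q : J -> R) (u : R) : R :=
  tcos x p u * tcos y q u + tsin x p u * tsin y q u.

Lemma bounded_mfun_tcos (I : finType) (x p : I -> R) : bounded_mfun (tcos x p).
Proof.
apply: bounded_mfun_sum => i; apply: bounded_mfunM; first exact: bounded_mfun_cst.
exact: bounded_mfun_cosw.
Qed.

Lemma bounded_mfun_tsin (I : finType) (x p : I -> R) : bounded_mfun (tsin x p).
Proof.
apply: bounded_mfun_sum => i; apply: bounded_mfunM; first exact: bounded_mfun_cst.
exact: bounded_mfun_sinw.
Qed.

Lemma bounded_mfun_tdot (I J : finType) (x p : I -> R) (y q : J -> R) :
  bounded_mfun (tdot x p y q).
Proof.
by apply: bounded_mfunD; apply: bounded_mfunM;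
  (exact: bounded_mfun_tcos || exact: bounded_mfun_tsin).
Qed.

Lemma tdotE (I J : finType) (x p : I -> R) (y q : J -> R) u :
  tdot x p y q u = \sum_i \sum_j x i * y j * cosw (q j - p i) u.
Proof.
rewrite /tdot /tcos /tsin !big_distrlr/= -big_split/=; apply: eq_bigr => i _.
rewrite -big_split/=; apply: eq_bigr => j _.
by rewrite -cosw_sub; ring.
Qed.

Lemma freq_int_tdot (I J : finType) (x p : I -> R) (y q : J -> R) g :
  bounded_mfun g ->
  freq_int (fun u => g u * tdot x p y q u) =
  \sum_i \sum_j x i * y j * freq_int (fun u => g u * cosw (q j - p i) u).
Proof.
move=> bg.
have bgc i j : bounded_mfun (fun u => g u * cosw (q j - p i) u).
  by apply: bounded_mfunM => //; exact: bounded_mfun_cosw.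
have bxgc i j : bounded_mfun (fun u => x i * y j * (g u * cosw (q j - p i) u)).
  by apply: bounded_mfunM => //; exact: bounded_mfun_cst.
under [X in freq_int X]eq_fun => u.
  rewrite tdotE mulr_sumr.
  under eq_bigr => i _.
    rewrite mulr_sumr; under eq_bigr do rewrite mulrCA; over.
  over.
rewrite freq_int_sum; last by move=> i; exact: bounded_mfun_sum.
apply: eq_bigr => i _; rewrite freq_int_sum//.
by apply: eq_bigr => j _; rewrite freq_intZ.
Qed.

Lemma freq_int_tdot1 (I J : finType) (x : I -> R) (p : I -> int)
    (y : J -> R) (q : J -> int) :
  freq_int (tdot x (fun i => (p i)%:~R) y (fun j => (q j)%:~R)) =
  \sum_i \sum_j x i * y j * (q j == p i)%:R.
Proof.
transitivity (freq_int (fun u => 1 *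
    tdot x (fun i => (p i)%:~R) y (fun j => (q j)%:~R) u)).
  by congr freq_int; apply/funext => u; rewrite mul1r.
rewrite (@freq_int_tdot _ _ _ _ _ _ (fun=> 1)); last exact: bounded_mfun_cst.
apply: eq_bigr => i _; apply: eq_bigr => j _; congr (_ * _).
rewrite -subr_eq0 -freq_int_cos; congr freq_int; apply/funext => u.
by rewrite mul1r /cosw intrB.
Qed.

(** Parseval's identity: exponentials with distinct integer frequencies are
    orthogonal. *)
Lemma freq_int_tdot_inj (I : finType) (x y : I -> R) (p : I -> nat) :
  injective p ->
  freq_int (tdot x (fun i => (p i)%:R) y (fun i => (p i)%:R)) = \sum_i x i * y i.
Proof.
move=> pinj; rewrite -[LHS]/(freq_int (tdot x (fun i => ((p i)%:Z)%:~R) y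
  (fun j => ((p j)%:Z)%:~R))) freq_int_tdot1.
apply: eq_bigr => i _; rewrite (bigD1 i)//= eqxx mulr1 big1 ?addr0// => j ij.
by rewrite eqz_nat (inj_eq pinj) (negbTE ij) mulr0.
Qed.

(** With [telescope_sinw], this is the identity
    [(1 - z) (z^p + ... + z^(q-1)) = z^p - z^q] at [z = exp(2 i pi u)], split
    into real and imaginary parts. *)
Lemma telescope_cosw (p q : nat) u : (p <= q)%N ->
  (1 - cosw 1 u) * (\sum_(p <= i < q) cosw i%:R u) +
    sinw 1 u * (\sum_(p <= i < q) sinw i%:R u) = cosw p%:R u - cosw q%:R u.
Proof.
move=> pq; have /= T := telescope_sumr (fun i => cosw i%:R u) pq.
rewrite !mulr_sumr -big_split/= -[RHS]opprB -T.
rewrite -sumrN; apply: eq_bigr => i _; rewrite -natr1 coswS; ring.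
Qed.

Lemma telescope_sinw (p q : nat) u : (p <= q)%N ->
  (1 - cosw 1 u) * (\sum_(p <= i < q) sinw i%:R u) -
    sinw 1 u * (\sum_(p <= i < q) cosw i%:R u) = sinw p%:R u - sinw q%:R u.
Proof.
move=> pq; have /= T := telescope_sumr (fun i => sinw i%:R u) pq.
rewrite !mulr_sumr -sumrN -big_split/= -[RHS]opprB -T.
rewrite -sumrN; apply: eq_bigr => i _; rewrite -natr1 sinwS; ring.
Qed.

(** This is [|1 - exp(2 i pi u)|^2]. *)
Definition gap (u : R) : R := 2 - 2 * cosw 1 u.

(** At [z = exp(2 i pi u)] this is
    [|1 - z|^2 |c + i s|^2 = |(1 - z) (c + i s)|^2]. *)
Lemma gapM (c s u : R) : gap u * (c ^+ 2 + s ^+ 2) =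
  ((1 - cosw 1 u) * c + sinw 1 u * s) ^+ 2 +
  ((1 - cosw 1 u) * s - sinw 1 u * c) ^+ 2.
Proof.
rewrite /gap; have := cosw2Dsinw2 1 u.
set a := cosw 1 u; set b := sinw 1 u => ab.
transitivity ((1 - 2 * a + (a ^+ 2 + b ^+ 2)) * (c ^+ 2 + s ^+ 2)); last by ring.
by rewrite ab; ring.
Qed.

Lemma gap_ge0 u : 0 <= gap u.
Proof.
by rewrite /gap subr_ge0 ler_piMr ?ler0n// cos_le1.
Qed.

(** Near 0 the constant [c] suffices; away from 0 the kernel [gap] is bounded
    below, so that a large multiple of it dominates the bound [G]. *)
Lemma le_gap_majorant (g : R -> R) (c d G : R) : 0 < d ->
  (forall u, D u -> `|u| < d -> g u <= c) -> (forall u, D u -> g u <= G) ->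
  exists2 B, 0 <= B & forall u, D u -> g u <= c + B * gap u.
Proof.
move=> d0 gc gG.
pose d' : R := Num.min d 2^-1.
have d'0 : 0 < d' by rewrite lt_min d0 invr_gt0 ltr0n.
have d'h : d' <= 2^-1 by rewrite ge_min lexx orbT.
pose k := 2 - 2 * cos (2 * pi * d').
have pi0 : 0 < (pi : R) by exact: pi_gt0.
have d'pi : 2 * pi * d' \in `[0, (pi : R)].
  rewrite in_itv/=; apply/andP; split; first by rewrite !mulr_ge0// ltW.
  have := ler_wpM2l (ltW pi0) d'h; lra.
have k0 : 0 < k.
  rewrite /k subr_gt0 gtr_pMr// -[ltRHS](@cos0 R) ltr_cos//.
    by rewrite !mulr_gt0.
  by rewrite in_itv/= lexx ltW.
(* Beyond the radius [d'] the kernel is at least [k]. *)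
exists (Num.max 0 (G - c) / k).
  by rewrite divr_ge0 ?(ltW k0)// le_max lexx.
move=> u Du; have [ud|du] := ltP `|u| d.
  apply: (le_trans (gc u Du ud)); rewrite lerDl.
  by rewrite mulr_ge0 ?gap_ge0// divr_ge0 ?(ltW k0)// le_max lexx.
apply: (le_trans (gG u Du)); rewrite -lerBlDl.
apply: (@le_trans _ _ (Num.max 0 (G - c))); first by rewrite le_max lexx orbT.
rewrite -mulrA ler_peMr ?le_max ?lexx// mulrC ler_pdivlMr// mul1r.
rewrite /k /gap /cosw lerD2l lerN2 ler_pM2l//.
have -> : cos (2 * pi * 1 * u) = cos (2 * pi * `|u|).
  by rewrite mulr1 -[LHS]cos_norm normrM ger0_norm// mulr_ge0// ltW.
have uh : `|u| <= 2^-1.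
  by move: Du; rewrite /freq_dom/= in_itv/= => /andP[u1 u2]; rewrite ler_norml u1 ltW.
have upi : 2 * pi * `|u| \in `[0, (pi : R)].
  rewrite in_itv/=; apply/andP; split; first by rewrite !mulr_ge0// ltW.
  have := ler_wpM2l (ltW pi0) uh; lra.
rewrite leNgt ltr_cos// -leNgt ler_pM2l ?mulr_gt0//.
by rewrite (le_trans _ du)// ge_min lexx.
Qed.

End trigonometric_polynomials.

(** * Quadratic forms of Toeplitz matrices *)

Section toeplitz_forms.
Context {R : realType}.
Local Notation D := (@freq_dom R).

Definition indicator (p q : nat) (i : nat) : R := (p <= i < q)%:R.

Lemma sum_indicator n p q (F : nat -> R) : (p <= q)%N -> (q <= n)%N ->
  \sum_(i < n) indicator p q i * F i = \sum_(p <= i < q) F i.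
Proof.
move=> pq qn; rewrite -(big_mkord xpredT (fun i => indicator p q i * F i)).
have pn := leq_trans pq qn.
rewrite (@big_cat_nat _ _ _ p)//= (@big_cat_nat _ _ _ q _ n)//=.
rewrite big_nat big1 ?add0r; last first.
  by move=> i /andP[_ ip]; rewrite /indicator leqNgt ip mul0r.
rewrite [X in _ + X]big_nat [X in _ + X]big1 ?addr0; last first.
  by move=> i /andP[qi _]; rewrite /indicator ltnNge qi andbF mul0r.
rewrite [LHS]big_nat [RHS]big_nat; apply: eq_bigr => i pqi.
by rewrite /indicator pqi mul1r.
Qed.

Lemma indicator_idem p q i : indicator p q i * indicator p q i = indicator p q i.
Proof. by rewrite /indicator; case: (_ <= _ < _)%N; rewrite ?mulr1 ?mulr0. Qed.

Lemma dot_indicator n p q : (p <= q)%N -> (q <= n)%N ->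
  dot (fun i : 'I_n => indicator p q i) (fun i : 'I_n => indicator p q i) =
  (q - p)%:R.
Proof.
move=> pq qn; rewrite /dot -(muln1 (q - p)%N) -sum_nat_const_nat natr_sum.
rewrite -(sum_indicator (fun=> 1) pq qn).
by apply: eq_bigr => i _; rewrite indicator_idem mulr1.
Qed.

Definition toeplitz_of (f : R -> R) n (S : 'M[R]_n) : Prop :=
  forall i j : 'I_n, S i j = freq_int (fun u => f u * cosw (j%:R - i%:R) u).

Definition tidx n (i : 'I_n) : R := i%:R.
(** The squared modulus of the trigonometric polynomial with coefficients [v]. *)
Definition energy n (v : 'I_n -> R) : R -> R := tdot v (@tidx n) v (@tidx n).

Lemma energy_ge0 n (v : 'I_n -> R) u : 0 <= energy v u.
Proof. by rewrite addr_ge0// -expr2 sqr_ge0. Qed.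

Lemma bounded_mfun_energy n (v : 'I_n -> R) : bounded_mfun (energy v).
Proof. exact: bounded_mfun_tdot. Qed.

Lemma freq_int_energy n (v : 'I_n -> R) : freq_int (energy v) = dot v v.
Proof. exact/freq_int_tdot_inj/val_inj. Qed.

Lemma quadE (f : R -> R) n (S : 'M[R]_n) (v : 'I_n -> R) :
  bounded_mfun f -> toeplitz_of f S ->
  quad S v = freq_int (fun u => f u * energy v u).
Proof.
move=> bf SE; rewrite freq_int_tdot//.
by apply: eq_bigr => i _; apply: eq_bigr => j _; rewrite SE.
Qed.

Lemma quad_lower_bound (f : R -> R) (fmin : R) n (S : 'M[R]_n) (v : 'I_n -> R) :
  bounded_mfun f -> (forall u, D u -> fmin <= f u) -> toeplitz_of f S ->
  fmin * dot v v <= quad S v.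
Proof.
move=> bf fm SE; rewrite (quadE _ bf SE) -freq_int_energy.
have bp := bounded_mfun_energy v.
rewrite -freq_intZ//; apply: le_freq_int.
- by apply: bounded_mfunM => //; exact: bounded_mfun_cst.
- exact: bounded_mfunM.
- by move=> u Du; rewrite ler_wpM2r ?energy_ge0// fm.
Qed.

(** Multiplication by [1 - z] leaves only the two end points of the block, each of
    modulus 1. *)
Lemma gap_energy_indicator n p q u : (p <= q)%N -> (q <= n)%N ->
  gap u * energy (fun i : 'I_n => indicator p q i) u <= 4.
Proof.
move=> pq qn; rewrite /energy /tdot /tcos /tsin.
rewrite (sum_indicator (fun i => cosw i%:R u) pq qn).
rewrite (sum_indicator (fun i => sinw i%:R u) pq qn).
rewrite -!expr2 gapM telescope_cosw// telescope_sinw//.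
have h1 := cosw2Dsinw2 p%:R u; have h2 := cosw2Dsinw2 q%:R u.
move: h1 h2; set a := cosw p%:R u; set b := cosw q%:R u.
set c := sinw p%:R u; set d := sinw q%:R u => h1 h2.
have := addr_ge0 (sqr_ge0 (a + b)) (sqr_ge0 (c + d)).
have -> : (a - b) ^+ 2 + (c - d) ^+ 2 = 2 * (a ^+ 2 + c ^+ 2) +
  2 * (b ^+ 2 + d ^+ 2) - ((a + b) ^+ 2 + (c + d) ^+ 2) by ring.
by rewrite h1 h2; lra.
Qed.

(** The variance of a block sum.  The block has so little energy away from
    frequency 0 that replacing [f] by the constant [c] costs an amount
    independent of its length. *)
Lemma quad_indicator_le (f : R -> R) (c B : R) n (S : 'M[R]_n) p q :
  bounded_mfun f -> toeplitz_of f S -> 0 <= B ->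
  (forall u, D u -> f u <= c + B * gap u) -> (p <= q)%N -> (q <= n)%N ->
  quad S (fun i : 'I_n => indicator p q i) <= c * (q - p)%:R + 4 * B.
Proof.
move=> bf SE B0 fle pq qn; rewrite (quadE _ bf SE).
rewrite -(dot_indicator pq qn) -freq_int_energy.
set v := (fun i : 'I_n => indicator p q i); have bp := bounded_mfun_energy v.
rewrite -(freq_int_cst (4 * B)) -freq_intZ// -freq_intD; last first.
- exact: bounded_mfun_cst.
- by apply: bounded_mfunM => //; exact: bounded_mfun_cst.
apply: le_freq_int.
- exact: bounded_mfunM.
- apply: bounded_mfunD; last exact: bounded_mfun_cst.
  by apply: bounded_mfunM => //; exact: bounded_mfun_cst.
- move=> u Du; apply: (le_trans (ler_wpM2r (energy_ge0 v u) (fle u Du))).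
  rewrite mulrDl lerD2l -mulrA [4 * B]mulrC ler_wpM2l//.
  exact: gap_energy_indicator.
Qed.

(** Integrates the pointwise inequality
    [f |v^|^2 >= 2 Re (v^ conj(w^)) - |w^|^2 / f] and bounds [1 / f] by its
    majorant.  It replaces the comparison of the inverse of a Toeplitz matrix with
    the Toeplitz matrix of the inverse symbol. *)
Lemma quad_linear_lower_bound (f : R -> R) (fmin c B : R) (E : R -> R) n
    (S : 'M[R]_n) (v w : 'I_n -> R) :
  bounded_mfun f -> toeplitz_of f S -> 0 < fmin ->
  (forall u, D u -> fmin <= f u) -> 0 <= B ->
  (forall u, D u -> (f u)^-1 <= c + B * gap u) ->
  bounded_mfun E -> (forall u, D u -> gap u * energy w u <= E u) ->
  2 * dot v w - (c * dot w w + B * freq_int E) <= quad S v.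
Proof.
move=> bf SE fmin0 fm B0 fV bE gE; rewrite (quadE _ bf SE).
have bpv := bounded_mfun_energy v; have bpw := bounded_mfun_energy w.
have bcst := bounded_mfun_cst.
have bvw : bounded_mfun (tdot v (@tidx n) w (@tidx n)).
  exact: bounded_mfun_tdot.
have -> : dot v w = freq_int (tdot v (@tidx n) w (@tidx n)).
  by apply/esym/freq_int_tdot_inj/val_inj.
rewrite -freq_int_energy -!freq_intZ// -freq_intD; [|exact: bounded_mfunM..].
rewrite -freq_intB; [|exact: bounded_mfunM|by apply: bounded_mfunD; exact: bounded_mfunM].
apply: le_freq_int.
- by apply: bounded_mfunB; [|apply: bounded_mfunD]; exact: bounded_mfunM.
- exact: bounded_mfunM.
move=> u Du; have fu0 : 0 < f u := lt_le_trans fmin0 (fm u Du).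
apply: (@le_trans _ _ (2 * tdot v (@tidx n) w (@tidx n) u - (f u)^-1 * energy w u)).
  rewrite lerD2l lerN2; apply: (le_trans (ler_wpM2r (energy_ge0 w u) (fV u Du))).
  by rewrite mulrDl lerD2l -mulrA ler_wpM2l// gE.
rewrite /energy /tdot.
set a := tcos v _ u; set b := tsin v _ u; set x := tcos w _ u; set y := tsin w _ u.
rewrite -subr_ge0.
have -> : f u * (a * a + b * b) - (2 * (a * x + b * y) - (f u)^-1 * (x * x + y * y))
  = (f u)^-1 * ((f u * a - x) ^+ 2 + (f u * b - y) ^+ 2).
  by field; rewrite gt_eqF.
by rewrite mulr_ge0 ?invr_ge0 ?(ltW fu0)// addr_ge0// sqr_ge0.
Qed.

Definition blocks (M N : nat) (x : 'I_N -> R) (i : nat) : R :=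
  \sum_k x k * indicator (k * M) (k.+1 * M) i.

(** Distinct blocks are disjoint, so no cross terms remain. *)
Lemma dot_blocks (M N n : nat) (x : 'I_N -> R) : (N * M <= n)%N ->
  dot (fun i : 'I_n => blocks M x i) (fun i : 'I_n => blocks M x i) =
  M%:R * dot x x.
Proof.
move=> NMn.
have le_k (k : 'I_N) : (k.+1 * M <= n)%N.
  by apply: leq_trans NMn; rewrite leq_mul2r ltn_ord orbT.
have blocks_sq i : blocks M x i * blocks M x i =
    \sum_k x k * x k * indicator (k * M) (k.+1 * M) i.
  rewrite /blocks big_distrlr/=; apply: eq_bigr => k _.
  rewrite (bigD1 k)//= big1 ?addr0 => [|l lk].
    by rewrite mulrACA indicator_idem.
  rewrite mulrACA /indicator -natrM mulnb.
  suff -> : ((k * M <= i < k.+1 * M) && (l * M <= i < l.+1 * M))%N = false.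
    by rewrite mulr0.
  apply/negbTE/negP => /andP[/andP[k1 k2] /andP[l1 l2]].
  have M0 : (0 < M)%N by move: k1 k2; case: (M) => //; rewrite !muln0.
  have lk1 : (l < k.+1)%N by rewrite -(ltn_pmul2r M0) (leq_ltn_trans l1).
  have kl1 : (k < l.+1)%N by rewrite -(ltn_pmul2r M0) (leq_ltn_trans k1).
  by case/negP: lk; rewrite -val_eqE; apply/eqP/anti_leq; rewrite -ltnS lk1 -ltnS.
rewrite /dot; under eq_bigr do rewrite blocks_sq.
rewrite exchange_big/= mulr_sumr; apply: eq_bigr => k _.
rewrite -mulr_sumr mulrC; congr (_ * _).
have kk : (k * M <= k.+1 * M)%N by rewrite leq_mul2r leqnSn orbT.
have := sum_indicator (fun=> 1) kk (le_k k).
under eq_bigr do rewrite mulr1.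
move=> ->; rewrite (_ : \sum_(_ <= _ < _) _ = (\sum_(k * M <= i < k.+1 * M) 1)%N%:R); last first.
  by rewrite natr_sum.
by rewrite sum_nat_const_nat muln1 mulSn addnK.
Qed.

(** Multiplication by [1 - z] leaves the two end points of each block.  For [M > 0]
    the left end points have distinct frequencies, and so have the right end
    points; this makes each of the two terms on the right integrate to
    [2 * dot x x]. *)
Lemma gap_energy_blocks (M N n : nat) (x : 'I_N -> R) u : (N * M <= n)%N ->
  gap u * energy (fun i : 'I_n => blocks M x i) u <=
  2 * tdot x (fun k => (k * M)%:R) x (fun k => (k * M)%:R) u +
  2 * tdot x (fun k => (k.+1 * M)%:R) x (fun k => (k.+1 * M)%:R) u.
Proof.
move=> NMn.
pose p0 (k : 'I_N) : R := (k * M)%:R; pose p1 (k : 'I_N) : R := (k.+1 * M)%:R.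
rewrite -/p0 -/p1.
have le_k (k : 'I_N) : (k.+1 * M <= n)%N.
  by apply: leq_trans NMn; rewrite leq_mul2r ltn_ord orbT.
have kk (k : 'I_N) : (k * M <= k.+1 * M)%N by rewrite leq_mul2r leqnSn orbT.
have sumE (F : nat -> R) : \sum_(i < n) blocks M x i * F i =
    \sum_k x k * \sum_(k * M <= i < k.+1 * M) F i.
  under eq_bigr do rewrite /blocks mulr_suml.
  rewrite exchange_big; apply: eq_bigr => k _ /=.
  rewrite -(sum_indicator F (kk k) (le_k k)) mulr_sumr.
  by apply: eq_bigr => i _; rewrite mulrA.
have cE : (1 - cosw 1 u) * (\sum_(i < n) blocks M x i * cosw i%:R u) +
    sinw 1 u * (\sum_(i < n) blocks M x i * sinw i%:R u) =
    tcos x p0 u - tcos x p1 u.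
  rewrite (sumE (fun i => cosw i%:R u)) (sumE (fun i => sinw i%:R u)).
  rewrite !mulr_sumr -big_split -sumrB; apply: eq_bigr => k _ /=.
  by rewrite -mulrBr -(telescope_cosw u (kk k)); ring.
have sE : (1 - cosw 1 u) * (\sum_(i < n) blocks M x i * sinw i%:R u) -
    sinw 1 u * (\sum_(i < n) blocks M x i * cosw i%:R u) =
    tsin x p0 u - tsin x p1 u.
  rewrite (sumE (fun i => cosw i%:R u)) (sumE (fun i => sinw i%:R u)).
  rewrite !mulr_sumr -!sumrB; apply: eq_bigr => k _ /=.
  by rewrite -mulrBr -(telescope_sinw u (kk k)); ring.
rewrite /energy /tdot -!expr2 gapM cE sE.
set a := tcos x p0 u; set b := tcos x p1 u; set c := tsin x p0 u; set d := tsin x p1 u.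
have := addr_ge0 (sqr_ge0 (a + b)) (sqr_ge0 (c + d)).
rewrite -subr_ge0 => h; rewrite -subr_ge0; apply: le_trans h _.
by rewrite le_eqVlt; apply/orP; left; apply/eqP; ring.
Qed.

(** Dual to [quad_indicator_le]: a step function has so little energy away from
    frequency 0 that [1 / f] may be replaced by the constant [c] up to a term
    independent of the length of the blocks.  With [v] the image of the step
    function under the inverse of [S], it bounds the inverse from above. *)
Lemma quad_blocks_lower_bound (f : R -> R) (fmin c B : R) (M N n : nat)
    (S : 'M[R]_n) (v : 'I_n -> R) (x : 'I_N -> R) :
  bounded_mfun f -> toeplitz_of f S -> 0 < fmin ->
  (forall u, D u -> fmin <= f u) -> 0 <= B ->
  (forall u, D u -> (f u)^-1 <= c + B * gap u) ->
  (0 < M)%N -> (N * M <= n)%N ->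
  2 * dot v (fun i => blocks M x i) - (c * M%:R + 4 * B) * dot x x <= quad S v.
Proof.
move=> bf SE fmin0 fm B0 fV M0 NMn.
pose p0 (k : 'I_N) : R := (k * M)%:R; pose p1 (k : 'I_N) : R := (k.+1 * M)%:R.
pose E u := 2 * tdot x p0 x p0 u + 2 * tdot x p1 x p1 u.
have b0 : bounded_mfun (tdot x p0 x p0) by exact: bounded_mfun_tdot.
have b1 : bounded_mfun (tdot x p1 x p1) by exact: bounded_mfun_tdot.
have bcst := bounded_mfun_cst.
have bE : bounded_mfun E by apply: bounded_mfunD; exact: bounded_mfunM.
have EE : freq_int E = 4 * dot x x.
  rewrite freq_intD; [|exact: bounded_mfunM..].
  rewrite !freq_intZ// (@freq_int_tdot_inj _ _ x x (fun k : 'I_N => (k * M)%N)).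
    rewrite (@freq_int_tdot_inj _ _ x x (fun k : 'I_N => (k.+1 * M)%N)).
      by rewrite -/(dot x x); ring.
    by move=> k l /eqP; rewrite eqn_pmul2r// => /eqP[] /val_inj.
  by move=> k l /eqP; rewrite eqn_pmul2r// => /eqP /val_inj.
apply: le_trans (quad_linear_lower_bound v bf SE fmin0 fm B0 fV bE _); last first.
  by move=> u _; exact: gap_energy_blocks.
by rewrite dot_blocks// EE le_eqVlt; apply/orP; left; apply/eqP; ring.
Qed.

End toeplitz_forms.

(** * The spectral density *)

Section spectral_density_bounds.
Context {R : realType}.
Local Notation D := (@freq_dom R).
Local Notation leb := (@lebesgue_measure R).

Lemma freq_dom_continuousP (f : R -> R) :
  {within `[- 2^-1, 2^-1[, continuous f} ->
  forall x, D x -> forall e, 0 < e ->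
  exists2 d, 0 < d & forall y, D y -> `|y - x| < d -> `|f y - f x| < e.
Proof.
move=> /subspace_continuousP fc x Dx e e0.
have /cvgrPdist_lt /(_ e e0) := fc x Dx.
rewrite near_withinE => /nbhs_ballP[d /= d0 H].
exists d => // y Dy yx; rewrite distrC; apply: H => //.
by rewrite /ball/= distrC.
Qed.

(** A value below the essential infimum would persist, by continuity, on an
    interval of positive length to the right of the point. *)
Lemma freq_ess_inf_lower_bound (f : R -> R) :
  {within `[- 2^-1, 2^-1[, continuous f} -> (0 < freq_ess_inf f)%E ->
  exists2 m : R, 0 < m & forall u, D u -> m <= f u.
Proof.
move=> fc fpos.
have [m m0 mf] : exists2 m : R, 0 < m & (m%:E <= freq_ess_inf f)%E.
  move: fpos; case: (freq_ess_inf f) => [r| |//]; rewrite ?lte_fin => r0.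
    by exists r.
  by exists 1; rewrite ?leey.
exists m => // u Du; rewrite leNgt; apply/negP => fum.
move: mf; rewrite /freq_ess_inf => /ess_infP[A [mA A0 sA]].
have e0 : 0 < m - f u by rewrite subr_gt0.
have [d d0 dP] := freq_dom_continuousP fc Du e0.
have u2 : u < 2^-1 by move: Du; rewrite /freq_dom/= in_itv/= => /andP[].
pose b := Num.min (u + d) 2^-1.
have ub : u < b by rewrite lt_min u2 ltrDl d0.
have sub : `[u, b[ `<=` A `&` D.
  move=> y /=; rewrite in_itv/= => /andP[uy yb].
  have Dy : D y.
    move: Du; rewrite /freq_dom/= !in_itv/= => /andP[h _].
    by rewrite (le_trans h uy)/= (lt_le_trans yb)// ge_min lexx orbT.
  split=> //; apply: sA => /=; rewrite lee_fin => mfy.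
  have : `|f y - f u| < m - f u.
    apply: dP => //; rewrite ger0_norm ?subr_ge0// ltrBlDl.
    by rewrite (lt_le_trans yb)// ge_min lexx.
  rewrite ltr_norml => /andP[_]; rewrite ltrD2r => h.
  by have := lt_le_trans h mfy; rewrite ltxx.
have : (leb `[u, b[ <= 0)%E.
  by rewrite -A0 /mrestr; apply: le_measure => //; rewrite inE;
    [exact: measurable_itv|apply: measurableI => //; exact: measurable_freq_dom].
by rewrite lebesgue_measure_itv/= lte_fin ub -EFinB lee_fin subr_le0 leNgt ub.
Qed.

(** The limit at [1/2] extends [f] to a continuous function on a compact interval. *)
Lemma spectral_density_upper_bound (f : R -> R) :
  {within `[- 2^-1, 2^-1[, continuous f} ->
  f nu @[nu --> 2^-1^'-] --> f (- 2^-1) ->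
  exists M, forall u, D u -> f u <= M.
Proof.
move=> fc fper.
pose g x := if x < 2^-1 then f x else f (- 2^-1).
have hl : - 2^-1 < 2^-1 :> R by lra.
have gf x : D x -> g x = f x.
  by rewrite /freq_dom/= in_itv/= /g => /andP[_ ->].
have gc : {within `[- 2^-1, 2^-1], continuous g}.
  apply/continuous_within_itvP => //; split.
  - move=> x xI; apply/cvgrPdist_lt => e e0.
    have Dx : D x by move: xI; rewrite /freq_dom/= !in_itv/= => /andP[/ltW -> ->].
    have [d d0 dP] := freq_dom_continuousP fc Dx e0.
    near=> y.
    have yI : y \in `]- 2^-1, 2^-1[ by near: y; exact: near_in_itvoo.
    have Dy : D y by move: yI; rewrite /freq_dom/= !in_itv/= => /andP[/ltW -> ->].
    by rewrite !gf// distrC dP// distrC; near: y; exact: nbhsx_ballx.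
  - apply/cvgrPdist_lt => e e0.
    have Dx : D (- 2^-1) by rewrite /freq_dom/= in_itv/= lexx.
    have [d d0 dP] := freq_dom_continuousP fc Dx e0.
    near=> y.
    have hy : - 2^-1 < y by near: y; exact: nbhs_right_gt.
    have Dy : D y.
      rewrite /freq_dom/= in_itv/= (ltW hy)/=; near: y; exact: nbhs_right_lt.
    rewrite !gf// distrC dP//.
    rewrite gtr0_norm ?subr_gt0// ltrBlDl; near: y.
    by apply: nbhs_right_lt; rewrite ltrDl.
  - have -> : g 2^-1 = f (- 2^-1) by rewrite /g ltxx.
    apply: cvg_trans fper; apply: near_eq_cvg; near=> y.
    rewrite /g ifT//; near: y; exact: nbhs_left_lt.
have [c _ cP] := EVT_max (ltW hl) gc.
exists (g c) => u Du; rewrite -gf//; apply: cP.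
by move: Du; rewrite /freq_dom/= !in_itv/= => /andP[-> /ltW].
Unshelve. all: by end_near. Qed.

Lemma bounded_mfun_spectral_density (f : R -> R) (m M : R) :
  {within `[- 2^-1, 2^-1[, continuous f} ->
  (forall u, D u -> m <= f u) -> (forall u, D u -> f u <= M) -> bounded_mfun f.
Proof.
move=> fc fm fM; split.
  by apply: subspace_continuous_measurable_fun => //; exact: measurable_freq_dom.
exists (`|m| + `|M|) => u Du; rewrite ler_norml; apply/andP; split.
  have := fm u Du; have := normr_ge0 M; have := ler_norm (- m); rewrite normrN; lra.
have := fM u Du; have := normr_ge0 m; have := ler_norm M; lra.
Qed.

Lemma freq_dom0 : D 0.
Proof. by rewrite /freq_dom/= in_itv/= oppr_le0 invr_ge0 ler0n invr_gt0 ltr0n. Qed.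

Lemma spectral_density_majorant (f : R -> R) (M c : R) :
  {within `[- 2^-1, 2^-1[, continuous f} -> (forall u, D u -> f u <= M) ->
  f 0 < c ->
  exists2 B, 0 <= B & forall u, D u -> f u <= c + B * gap u.
Proof.
move=> fc fM fc0; have e0 : 0 < c - f 0 by rewrite subr_gt0.
have [d d0 dP] := freq_dom_continuousP fc freq_dom0 e0.
apply: (le_gap_majorant d0 _ fM) => u Du ud.
have := dP u Du; rewrite subr0 => /(_ ud).
by rewrite ltr_norml => /andP[_]; rewrite ltrD2r => /ltW.
Qed.

Lemma inv_spectral_density_majorant (f : R -> R) (m c : R) :
  {within `[- 2^-1, 2^-1[, continuous f} -> 0 < m ->
  (forall u, D u -> m <= f u) -> 0 < c -> c < f 0 ->
  exists2 B, 0 <= B & forall u, D u -> (f u)^-1 <= c^-1 + B * gap u.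
Proof.
move=> fc m0 fm c0 cf0; have e0 : 0 < f 0 - c by rewrite subr_gt0.
have [d d0 dP] := freq_dom_continuousP fc freq_dom0 e0.
apply: (@le_gap_majorant _ (fun u => (f u)^-1) _ d m^-1 d0) => u Du.
  move=> ud; have := dP u Du; rewrite subr0 => /(_ ud).
  rewrite ltr_norml => /andP[h _].
  rewrite lef_pV2 ?posrE//; first by move: h; lra.
  exact: lt_le_trans m0 (fm u Du).
rewrite lef_pV2 ?posrE//; first exact: fm.
exact: lt_le_trans m0 (fm u Du).
Qed.

End spectral_density_bounds.

(** * Scan tests *)

Section scan_test.
Context {R : realType}.

Lemma dot_affine_map n (m : 'cV[R]_n) (A : 'M[R]_n) (v : 'I_n -> R) z :
  dot v (tnth (affine_map m A z)) =
  dot v (fun i => m i 0) + dot (mxform A v) (tnth z).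
Proof.
rewrite /dot /mxform.
under eq_bigr do rewrite tnth_mktuple mulrDr mulr_sumr.
rewrite big_split/=; congr (_ + _); rewrite exchange_big; apply: eq_bigr => j _ /=.
by rewrite mulr_suml; apply: eq_bigr => i _; rewrite mulrA.
Qed.

Lemma measurable_dot_ge n (v : 'I_n -> R) (t : R) :
  measurable [set y : n.-tuple R | t <= dot v (tnth y)].
Proof.
rewrite (_ : [set _ | _] =
  (fun z : n.-tuple R => dot v (tnth z)) @^-1` `[t, +oo[%classic).
  by rewrite -[_ @^-1` _]setTI; apply: measurable_dot.
by apply/seteqP; split => z /=; rewrite in_itv/= andbT.
Qed.

Lemma gaussian_law_tail n (m : 'cV[R]_n) (S : 'M[R]_n) (v : 'I_n -> R) (s t : R) :
  is_covariance_mx S -> 0 < s -> quad S v <= s -> 0 <= t ->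
  (gaussian_law m S [set y | (dot v (fun i => m i 0) + t <= dot v (tnth y))%R] <=
   (expR (- (t ^+ 2 / (2 * s))))%:E)%E.
Proof.
move=> cS s0 vs t0.
have -> : gaussian_law m S [set y | dot v (fun i => m i 0) + t <= dot v (tnth y)] =
    std_gaussian n [set z | t <= dot (mxform (mx_root S) v) (tnth z)].
  congr (std_gaussian n _); apply/seteqP.
  by split => z /=; rewrite dot_affine_map lerD2l.
by apply: std_gaussian_tail => //; rewrite dot_mxform mx_rootP.
Qed.

Definition scan_region n (K : nat) (V : nat -> 'I_n -> R) (t : nat -> R) :
    set (n.-tuple R) :=
  \big[setU/set0]_(k < K) [set y | t k < `|dot (V k) (tnth y)|].

Lemma measurable_scan_stat n (v : 'I_n -> R) (t : R) :
  measurable [set y : n.-tuple R | t < `|dot v (tnth y)|].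
Proof.
rewrite (_ : [set _ | _] =
  (fun z : n.-tuple R => `|dot v (tnth z)|) @^-1` `]t, +oo[%classic).
  rewrite -[_ @^-1` _]setTI; apply: measurableT_comp => //.
  exact: measurable_dot.
by apply/seteqP; split => z /=; rewrite in_itv/= andbT.
Qed.

Lemma measurable_scan_region n K (V : nat -> 'I_n -> R) (t : nat -> R) :
  measurable (scan_region K V t).
Proof. by apply: bigsetU_measurable => k _; exact: measurable_scan_stat. Qed.

Definition scan_rejects n K (V : nat -> 'I_n -> R) (t : nat -> R) (y : n.-tuple R) :
  bool := y \in scan_region K V t.

Lemma measurable_scan_rejects n K (V : nat -> 'I_n -> R) (t : nat -> R) :
  measurable_fun setT (scan_rejects K V t).
Proof.
apply: (measurable_fun_bool true); rewrite setTI.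
rewrite (_ : _ @^-1` _ = scan_region K V t); first exact: measurable_scan_region.
by apply/seteqP; split => y; [exact: set_mem|exact: mem_set].
Qed.

HB.instance Definition _ n K V t :=
  isMeasurableFun.Build _ _ _ _ (@scan_rejects n K V t) (@measurable_scan_rejects n K V t).

Definition scan_test n K V t : test R n := (@scan_rejects n K V t : {mfun _ >-> _}).

(** The threshold of each window gives its two-sided test a level of at most
    [a / K]. *)
Lemma scan_test_type1 n (S : 'M[R]_n) K (V : nat -> 'I_n -> R) (s : nat -> R) (a : R) :
  is_covariance_mx S -> (0 < K)%N -> 0 < a < 1 ->
  (forall k, 0 < s k) -> (forall k, quad S (V k) <= s k) ->
  (type1_error (scan_test K V
    (fun k => Num.sqrt (2 * s k * ln (2 * K%:R / a)))) S <= a%:E)%E.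
Proof.
move=> cS K0 /andP[a0 a1] s0 Vs; set t := fun k => _.
have K0' : 0 < K%:R :> R by rewrite ltr0n.
have l0 : 0 <= ln (2 * K%:R / a).
  have K1 : 1 <= K%:R :> R by rewrite ler1n.
  by rewrite ln_ge0// ler_pdivlMr// mul1r; lra.
rewrite /type1_error (_ : [set _ | _] = scan_region K V t); last first.
  by apply/seteqP; split => y; [exact: set_mem|exact: mem_set].
apply: (le_trans (@Boole_inequality _ _ _ (gaussian_law 0 S)
    (fun k => [set y | t k < `|dot (V k) (tnth y)|]) K _)).
  by move=> k _; exact: measurable_scan_stat.
apply: (@le_trans _ _ (\sum_(k < K) (a / K%:R)%:E)%E); last first.
  by rewrite sumEFin sumr_const card_ord -[_ *+ _]mulr_natr divfK ?gt_eqF.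
apply: lee_sum => k _.
have ht : expR (- (t k ^+ 2 / (2 * s k))) = a / (2 * K%:R).
  rewrite sqr_sqrtr ?mulr_ge0 ?(ltW (s0 k))//.
  rewrite mulrAC divff ?mul1r; last by rewrite mulf_neq0 ?gt_eqF.
  by rewrite expRN lnK ?posrE ?divr_gt0 ?mulr_gt0// invf_div.
have tail v : quad S v <= s k ->
    (gaussian_law 0 S [set y | (t k <= dot v (tnth y))%R] <= (a / (2 * K%:R))%:E)%E.
  move=> vs; have := @gaussian_law_tail n 0 S v (s k) (t k) cS (s0 k) vs (sqrtr_ge0 _).
  have -> : dot v (fun i => (0 : 'cV[R]_n) i 0) = 0.
    by rewrite /dot big1// => i _; rewrite mxE mulr0.
  by rewrite ht add0r.
have -> : a / K%:R = a / (2 * K%:R) + a / (2 * K%:R) by field; rewrite gt_eqF.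
rewrite EFinD; apply: le_trans; last first.
  apply: leeD; [exact: (tail (V k))|apply: (tail (fun i => - V k i))].
  by rewrite quadN.
apply: le_trans (measureU2 _ _ _); [|exact: measurable_dot_ge..].
apply: le_measure; rewrite ?inE; [exact: measurable_scan_stat| |].
  by apply: measurableU; exact: measurable_dot_ge.
by move=> y /=; rewrite dotNl lter_normr => /orP[/ltW ?|/ltW ?]; [left|right].
Qed.

(** A single window is enough: if the test does not reject, the noise in window
    [k] compensates the excess [x] of the signal over the threshold. *)
Lemma scan_test_type2 n (S : 'M[R]_n) (m : 'cV[R]_n) K (V : nat -> 'I_n -> R)
    (t : nat -> R) k (s x : R) :
  is_covariance_mx S -> (k < K)%N -> 0 < s -> quad S (V k) <= s -> 0 <= x ->
  t k + x <= `|dot (V k) (fun i => m i 0)| ->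
  (gaussian_law m S [set y | scan_test K V t y = false] <=
   (expR (- (x ^+ 2 / (2 * s))))%:E)%E.
Proof.
move=> cS kK s0 Vs x0 txm.
pose sg : R := if 0 <= dot (V k) (fun i => m i 0) then -1 else 1.
pose v i := sg * V k i.
have dv w : dot v w = sg * dot (V k) w.
  by rewrite /dot mulr_sumr; apply: eq_bigr => i _; rewrite mulrA.
have vs : quad S v <= s.
  rewrite (_ : quad S v = quad S (V k))//.
  apply: eq_bigr => i _; apply: eq_bigr => j _; rewrite mulrACA.
  by rewrite /sg; case: ifP => _; rewrite ?mulrNN !mul1r.
apply: le_trans (gaussian_law_tail m cS s0 vs x0).
apply: le_measure; rewrite ?inE; [|exact: measurable_dot_ge|].
  rewrite (_ : [set _ | _] = ~` scan_region K V t).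
    by apply: measurableC; exact: measurable_scan_region.
  apply/seteqP; split => y /=; first by rewrite /scan_rejects => /negbT/negP; rewrite inE.
  by move=> h; apply/negbTE/negP; rewrite inE.
move=> y /= yF; rewrite !dv.
have : `|dot (V k) (tnth y)| <= t k.
  rewrite leNgt; apply/negP => h; move/negbT/negP : yF; apply.
  apply/mem_set.
  exact: (@bigsetU_sup _ _ _
    (fun k => [set y : n.-tuple R | t k < `|dot (V k) (tnth y)|]) kK y h).
rewrite /sg; move: txm; case: ger0P => h; rewrite ler_norml => h1 /andP[h2 h3]; lra.
Qed.

End scan_test.

(** * Detection by a scan test *)

Section scan_asymptotics.
Context {R : realType}.

Definition window (s w k n : nat) (i : 'I_n) : R := indicator (k * s) (k * s + w) i.

Lemma natrB_ge (m p : nat) : m%:R - p%:R <= (m - p)%N%:R :> R.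
Proof.
have [pm|/ltnW mp] := leqP p m; first by rewrite natrB.
by rewrite (le_trans _ (ler0n _ _))// subr_le0 ler_nat.
Qed.

(** The window that starts at the first grid point after the left end of the
    interval misses the interval by at most [s + 1] of its points. *)
Lemma window_overlap (n s : nat) (lam delta a b : R) : (0 < n)%N -> (0 < s)%N ->
  0 <= a -> a < b -> b <= 1 -> b - a = lam ->
  let w := Num.truncn (n%:R * lam) in
  exists2 k, (k < n %/ s + 2)%N &
    `|delta| * (w - s.+1)%N%:R <=
    `|dot (@window s w k n) (fun i => (delta *: indic_vec n `[a, b[%classic) i 0)|.
Proof.
move=> n0 s0 a0 ab b1 bal w.
have n0' : 0 < n%:R :> R by rewrite ltr0n.
pose t := Num.truncn (n%:R * a).
have na0 : 0 <= n%:R * a by rewrite mulr_ge0.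
have /andP[t1 t2] := truncn_itv na0; rewrite -/t in t1 t2.
have lam0 : 0 < lam by rewrite -bal subr_gt0.
have /andP[w1 w2] := truncn_itv (mulr_ge0 (ltW n0') (ltW lam0)); rewrite -/w in w1 w2.
have nb : n%:R * b = n%:R * a + n%:R * lam by rewrite -mulrDr -bal addrC subrK.
have nbn : n%:R * b <= n%:R by rewrite ler_piMr// ltW.
have tn : (t <= n)%N.
  rewrite -(ler_nat R) (le_trans t1)// (le_trans _ nbn)// nb lerDl mulr_ge0//; exact: ltW.
(* The design point of index [i] is [(i + 1) / n], and [t + 1 > n a]: the points
   of index at least [t] lie to the right of [a].  The chosen start exceeds [t]. *)
exists (t %/ s).+1.
  by rewrite addn2 !ltnS leq_div2r.
set k := (t %/ s).+1.
have tk : (t < k * s)%N by rewrite /k ltn_ceil.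
have kt : (k * s <= t + s)%N by rewrite /k mulSn addnC leq_add2r leq_divM.
have -> : dot (@window s w k n)
    (fun i => (delta *: indic_vec n `[a, b[%classic) i 0) =
  delta * \sum_(i < n) indicator (k * s) (k * s + w) i *
    \1_(`[a, b[%classic) (i.+1%:R / n%:R).
  rewrite /dot mulr_sumr; apply: eq_bigr => i _.
  by rewrite /window !mxE; ring.
have ge0 (i : 'I_n) : 0 <= indicator (k * s) (k * s + w) i *
    \1_(`[a, b[%classic) (i.+1%:R / n%:R) :> R by rewrite mulr_ge0// ler0n.
rewrite normrM ler_wpM2l// ger0_norm; last exact: sumr_ge0.
have [ws|sw] := leqP w s.+1.
  by move: ws; rewrite /leq => /eqP ->; exact: sumr_ge0.
pose q := (k * s + (w - s.+1))%N.
have qtw : (q.+1 <= t + w)%N.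
  apply: (@leq_trans (t + s + (w - s.+1)).+1); first by rewrite ltnS leq_add2r.
  by rewrite -addnA -addnS -(addSn s) subnKC ?leqnn// ltnW.
have twb : (t + w)%:R <= n%:R * b by rewrite nb natrD lerD.
have qn : (q <= n)%N.
  rewrite -(ler_nat R) (le_trans _ nbn)// (le_trans _ twb)// ler_nat; exact: ltnW.
have kq : (k * s <= q)%N by rewrite leq_addr.
apply: (@le_trans _ _ (\sum_(i < n) indicator (k * s) q i * 1)).
  rewrite (sum_indicator (fun=> 1) kq qn) (_ : \sum_(_ <= _ < _) 1 =
    (\sum_(k * s <= i < q) 1)%N%:R); last by rewrite natr_sum.
  by rewrite sum_nat_const_nat muln1 ler_nat /q addKn.
apply: ler_sum => i _; rewrite mulr1 /indicator.
case: (boolP (k * s <= i < q)%N) => [/andP[ki iq]|_]; last exact: ge0.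
rewrite ki (leq_trans iq) ?leq_add2l ?leq_subr//= mul1r indicE mem_set//=.
rewrite in_itv/= ler_pdivlMr// ltr_pdivrMr// ![_ * n%:R]mulrC.
rewrite (le_trans (ltW t2)) ?ler_nat ?ltnS; last by rewrite (leq_trans _ ki)// ltnW.
rewrite (lt_le_trans _ twb)// ltr_nat; apply: leq_trans qtw; by rewrite ltnS.
Qed.

Lemma ln_le_2sqrt (x : R) : 0 < x -> ln x <= 2 * Num.sqrt x.
Proof.
move=> x0; have s0 : 0 < Num.sqrt x by rewrite sqrtr_gt0.
rewrite -{1}(sqr_sqrtr (ltW x0)) lnXn// -[ln _ *+ _]mulr_natl ler_wpM2l//.
have := @le_ln1Dx R (Num.sqrt x - 1).
rewrite (_ : 1 + (Num.sqrt x - 1) = Num.sqrt x); last lra.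
move=> h; apply: le_trans (h _) _; last by rewrite lerBlDr lerDl.
by rewrite ltrBrDl subrr.
Qed.

(** A factor [c > 1] pays for five losses of a factor [th]; this is Bernoulli's
    inequality at [th = 1 - (1 - c^-1) / 5]. *)
Lemma slack_exists (c : R) : 1 < c -> exists2 th : R, 0 < th < 1 & 1 <= c * th ^+ 5.
Proof.
move=> c1; have c0 : 0 < c by lra.
pose x := (1 - c^-1) / 5.
have ci : 0 < c^-1 < 1 by rewrite invr_gt0 c0 invf_lt1.
have /andP[ci0 ci1] := ci.
have x0 : 0 < x by rewrite divr_gt0//; lra.
have x5 : x * 5 = 1 - c^-1 by rewrite divfK.
exists (1 - x); first by apply/andP; split; lra.
have h2 : 1 - 2 * x <= (1 - x) ^+ 2 by rewrite -subr_ge0 (_ : _ - _ = x ^+ 2) ?sqr_ge0//; ring.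
have h4 : 1 - 4 * x <= (1 - x) ^+ 4.
  apply: (@le_trans _ _ ((1 - 2 * x) ^+ 2)).
    by have := sqr_ge0 x; nra.
  by rewrite -[4%N]/(2 * 2)%N exprM ler_pXn2r// nnegrE; [lra|exact: sqr_ge0].
have h5 : c^-1 <= (1 - x) ^+ 5.
  apply: (@le_trans _ _ ((1 - 4 * x) * (1 - x))).
    by have := sqr_ge0 x; nra.
  by rewrite exprSr ler_wpM2r//; lra.
by rewrite -(ler_pM2l c0) mulfV ?gt_eqF// in h5.
Qed.

(** The windows start at the multiples of about [n lam / L], where
    [L = - ln lam]. *)
Lemma window_count_le (n : nat) (lam : R) : 0 < lam -> 2 <= - ln lam ->
  0 < n%:R * lam ->
  (n %/ (Num.truncn (n%:R * lam / - ln lam)).+1 + 2)%N%:R <= 2 * - ln lam / lam.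
Proof.
move=> lam0; set L := - ln lam; set X := n%:R * lam => L2 X0.
have L0 : 0 < L by apply: lt_le_trans L2.
have /andP[_ s2] := truncn_itv (ltW (divr_gt0 X0 L0)).
set s := (Num.truncn _).+1 in s2 *.
have ns : (n %/ s)%N%:R <= L / lam.
  apply: (@le_trans _ _ (n%:R / s%:R)).
    by rewrite ler_pdivlMr ?ltr0n// -natrM ler_nat leq_divM.
  rewrite ler_pdivrMr ?ltr0n// mulrAC ler_pdivlMr// -/X.
  by rewrite mulrC -ler_pdivrMr// ltW.
have lam1 : lam <= 1.
  rewrite leNgt; apply/negP => /ltW/ln_ge0; rewrite -oppr_le0 -/L.
  by rewrite leNgt L0.
have : 2 <= L / lam.
  by rewrite ler_pdivlMr//; apply: le_trans L2; rewrite ler_piMr.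
by rewrite natrD -mulrA; move: ns; clear; lra.
Qed.

(** The logarithm of the count is at most [L + ln L + O(1)], and [ln L] is at most
    [2 * Num.sqrt L], so the square root exceeds that of [L] by a bounded amount
    only. *)
Lemma sqrt_log_count_le (K : nat) (lam alpha : R) : 0 < lam -> 0 < - ln lam ->
  0 < alpha < 1 -> (0 < K)%N -> K%:R <= 2 * - ln lam / lam ->
  Num.sqrt (ln (2 * K%:R / alpha)) <=
  Num.sqrt (- ln lam) + 1 + ln (4 / alpha).
Proof.
move=> lam0 L0 /andP[al0 al1] K0 KL.
have K0' : 0 < K%:R :> R by rewrite ltr0n.
set L := - ln lam in L0 KL *; set a := ln (4 / alpha).
have a0 : 0 <= a.
  rewrite ln_ge0// ler_pdivlMr// mul1r (le_trans (ltW al1))//.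
  by rewrite ler1n.
set y := Num.sqrt L.
have y0 : 0 < y by rewrite sqrtr_gt0.
have yy : y ^+ 2 = L by rewrite sqr_sqrtr// ltW.
rewrite -[leRHS]ger0_norm; last by rewrite !addr_ge0// ltW.
rewrite -sqrtr_sqr ler_wsqrtr//.
apply: (@le_trans _ _ (ln (L * lam^-1 * (4 / alpha)))).
  rewrite ler_ln ?posrE ?mulr_gt0 ?invr_gt0//.
  rewrite [leRHS]mulrA ler_pM2r ?invr_gt0//.
  by apply: (le_trans (ler_wpM2l _ KL)) => //; clear; lra.
rewrite lnM ?posrE ?mulr_gt0 ?invr_gt0// -/a.
rewrite lnM ?posrE ?invr_gt0// lnV ?posrE// -/L.
have -> : (y + 1 + a) ^+ 2 = y ^+ 2 + 2 * y + a + (a ^+ 2 + 2 * (y * a) + 1 + a).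
  by ring.
rewrite yy; have := ln_le_2sqrt L0; rewrite -/y.
have := mulr_ge0 (ltW y0) a0; have := sqr_ge0 a; move: a0; clear; lra.
Qed.

Lemma window_loss_le (th X L : R) (w s : nat) : th < 1 -> 0 < X -> 0 < L ->
  6 / (1 - th) <= L -> 6 / (1 - th) <= X ->
  X < w.+1%:R -> s%:R <= X / L ->
  th * X <= (w - s.+2)%N%:R.
Proof.
move=> th1 X0 L0; have u0 : 0 < 1 - th by rewrite subr_gt0.
rewrite !ler_pdivrMr// => AL AX w2 s1.
apply: le_trans (natrB_ge _ _).
have h1 : X / L <= X * (1 - th) / 2.
  rewrite ler_pdivrMr// -mulrA -mulrA ler_peMr ?(ltW X0)//.
  by move: AL; clear; lra.
move: h1 AX w2 s1; rewrite -[s.+2%:R]natr1 -[s.+1%:R]natr1 -[w.+1%:R]natr1.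
by clear; lra.
Qed.

(** On the right is the signal in the best window, on the left the threshold plus
    the deviation that makes the type II error at most [alpha].  After squaring,
    replacing the variance by [c f(0) n lam] loses one factor [th], replacing the
    logarithm by [L] two, and the incomplete overlap two more. *)
Lemma scan_slack (c f0 B alpha : R) : 1 < c -> 0 < f0 -> 0 <= B -> 0 < alpha < 1 ->
  exists A : R, forall (n : nat) (lam : R), 0 < lam -> A <= - ln lam ->
    A <= n%:R * lam ->
    let L := - ln lam in let w := Num.truncn (n%:R * lam) in
    let s := (Num.truncn (n%:R * lam / L)).+1 in
    let K := (n %/ s + 2)%N in
    forall sg, 0 < sg -> sg <= c * f0 * w%:R + 4 * B + 1 ->
    Num.sqrt (2 * sg * ln (2 * K%:R / alpha)) + Num.sqrt (2 * sg * ln alpha^-1) <=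
    c * Num.sqrt (2 * f0 * L / (n%:R * lam)) * (w - s.+1)%N%:R.
Proof.
move=> c1 f00 B0 alpha01.
have c0 : 0 < c by apply: lt_trans c1.
have [th /andP[th0 th1] cth] := slack_exists c1.
pose d := 1 + ln (4 / alpha) + Num.sqrt (ln alpha^-1).
have d0 : 0 <= d.
  have /andP[al0 al1] := alpha01.
  rewrite !addr_ge0 ?sqrtr_ge0// ln_ge0// ler_pdivlMr// mul1r.
  by rewrite (le_trans (ltW al1))// ler1n.
have u0 : 0 < 1 - th by rewrite subr_gt0.
pose e := th / (1 - th); have e0 : 0 < e by rewrite divr_gt0.
pose A1 := (d * e) ^+ 2; pose A2 := (4 * B + 1) / (c * f0) * e.
pose A3 := 6 / (1 - th).
have cf0 : 0 < c * f0 by rewrite mulr_gt0.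
have A10 : 0 <= A1 by exact: sqr_ge0.
have A20 : 0 <= A2.
  by rewrite mulr_ge0 ?(ltW e0)// divr_ge0 ?(ltW cf0)// addr_ge0// mulr_ge0.
have A30 : 0 <= A3 by rewrite divr_ge0// ltW.
exists (2 + A1 + A2 + A3) => n lam lam0; set X := n%:R * lam.
set Lam := - ln lam => AL AX L w s K sg sg0 sgle; rewrite /L.
have [[L2 AL1] AL3] : (2 <= Lam /\ A1 <= Lam) /\ A3 <= Lam.
  by move: AL A10 A20 A30; clear; lra.
have [[X2 AX2] AX3] : (2 <= X /\ A2 <= X) /\ A3 <= X.
  by move: AX A10 A20 A30; clear; lra.
have L0 : 0 < Lam by apply: lt_le_trans L2.
have X0 : 0 < X by apply: lt_le_trans X2.
have /andP[w1 w2] := truncn_itv (ltW X0); rewrite -/w in w1 w2.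
have /andP[s1 _] := truncn_itv (ltW (divr_gt0 X0 L0)).
have ov : th * X <= (w - s.+1)%N%:R by exact: (window_loss_le th1 X0 L0).
have K0 : (0 < K)%N by rewrite /K addn2.
have := sqrt_log_count_le lam0 L0 alpha01 K0 (window_count_le lam0 L2 X0).
clearbody K w s; rewrite -/Lam; set l := ln (2 * K%:R / alpha).
set y := Num.sqrt Lam => sl; set b := ln alpha^-1.
have y0 : 0 < y by rewrite sqrtr_gt0.
have yy : y ^+ 2 = Lam by rewrite sqr_sqrtr// ltW.
(* The bounded excess [d] is absorbed once [y], the square root of [- ln lam], is
   large. *)
have yd : y + d <= y / th.
  have de0 : 0 <= d * e by rewrite mulr_ge0// ltW.
  have : d * e <= y.
    by rewrite -(@ler_pXn2r _ 2) ?nnegrE ?(ltW y0)// yy.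
  rewrite /e mulrA ler_pdivrMr// ler_pdivlMr// mulrBr mulr1.
  by move=> h; rewrite mulrDl -lerBrDl.
have sgX : sg <= c * f0 * X / th.
  apply: (le_trans sgle); rewrite ler_pdivlMr//.
  have h1 : c * f0 * w%:R <= c * f0 * X by rewrite ler_pM2l.
  apply: (@le_trans _ _ ((c * f0 * X + (4 * B + 1)) * th)).
    by rewrite ler_pM2r// -addrA lerD2r.
  move: AX2; rewrite /A2 /e mulrA ler_pdivrMr// mulrAC ler_pdivrMr//.
  by rewrite mulrDl; clear; lra.
have sg2 : 0 <= 2 * sg by rewrite mulr_ge0// ltW.
rewrite !(sqrtrM _ sg2) -mulrDr.
apply: (@le_trans _ _ (Num.sqrt (2 * (c * f0 * X / th)) * (y / th))).
  apply: ler_pM; [exact: sqrtr_ge0|by rewrite addr_ge0 ?sqrtr_ge0| |].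
    by rewrite ler_wsqrtr// ler_wpM2l.
  by apply: le_trans yd; rewrite /d !addrA lerD2r.
apply: (@le_trans _ _ (c * Num.sqrt (2 * f0 * Lam / X) * (th * X))); last first.
  by apply: ler_wpM2l ov; rewrite mulr_ge0 ?sqrtr_ge0// ltW.
have q0 : 0 <= th * X by rewrite mulr_ge0// ltW.
have q1 : 0 <= 2 * (c * f0 * X / th).
  by apply: mulr_ge0 => //; rewrite divr_ge0 ?mulr_ge0// ltW.
have q2 : 0 <= 2 * f0 * Lam / X.
  by rewrite divr_ge0 ?(ltW X0)// mulr_ge0 ?(ltW L0)// mulr_ge0// ltW.
rewrite -(@ler_pXn2r _ 2) ?nnegrE//; first last.
- by rewrite mulr_ge0 ?q0// mulr_ge0 ?sqrtr_ge0// ltW.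
- by rewrite mulr_ge0 ?sqrtr_ge0// divr_ge0// ltW.
have -> : (Num.sqrt (2 * (c * f0 * X / th)) * (y / th)) ^+ 2 =
    2 * (c * f0 * X / th) * (Lam * th^-1 ^+ 2).
  by rewrite exprMn sqr_sqrtr// exprMn yy.
have -> : (c * Num.sqrt (2 * f0 * Lam / X) * (th * X)) ^+ 2 =
    c ^+ 2 * (2 * f0 * Lam / X) * (th ^+ 2 * X ^+ 2).
  by rewrite exprMn [(c * _) ^+ 2]exprMn sqr_sqrtr// exprMn.
have -> : 2 * (c * f0 * X / th) * (Lam * th^-1 ^+ 2) = 2 * c * f0 * X * Lam / th ^+ 3.
  by field; rewrite gt_eqF.
have -> : c ^+ 2 * (2 * f0 * Lam / X) * (th ^+ 2 * X ^+ 2) =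
  (2 * c * f0 * X * Lam) * (c * th ^+ 2) by field; rewrite gt_eqF.
apply: ler_wpM2l.
  by rewrite mulr_ge0 ?(ltW L0)// mulr_ge0 ?(ltW X0)// -mulrA mulr_ge0// ltW.
by rewrite -div1r ler_pdivrMr ?exprn_gt0// -mulrA -exprD.
Qed.

End scan_asymptotics.

Section limit_superior.
Context {R : realType}.

Lemma limn_esup_le_near (u : nat -> \bar R) (a : \bar R) :
  (\forall n \near \oo, (u n <= a)%E) -> (limn_esup u <= a)%E.
Proof.
move=> ua; apply: (@le_trans _ _ (ereal_sup (u @` [set n | (u n <= a)%E]))).
  by apply: ereal_inf_lbound; exists [set n | (u n <= a)%E].
by apply: ge_ereal_sup => _ [n /= una <-].
Qed.

Lemma limn_einf_ge_near (u : nat -> \bar R) (a : \bar R) :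
  (\forall n \near \oo, (a <= u n)%E) -> (a <= limn_einf u)%E.
Proof.
move=> ua; rewrite /limn_einf leeNr; apply: limn_esup_le_near.
by apply: filterS ua => n; rewrite leeN2.
Qed.

Lemma limn_esup_near_le (u : nat -> \bar R) (a e : R) :
  (limn_esup u <= a%:E)%E -> 0 < e ->
  \forall n \near \oo, (u n <= (a + e)%:E)%E.
Proof.
move=> ua e0.
have : (limn_esup u < (a + e)%:E)%E.
  by apply: le_lt_trans ua _; rewrite lte_fin ltrDl.
move=> /ereal_inf_lt [_ [V VF <-] supV].
apply: filterS VF => n Vn; apply: le_trans (ltW supV).
by apply: ereal_sup_ubound; exists n.
Qed.

End limit_superior.

Section scale.
Context {R : realType}.

(** Both scales of the problem diverge: the logarithm of [1 / lambda n] and the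
    number of design points in an interval. *)
Lemma scale_asymptotics (lambda : nat -> R)
    (lambda01 : forall n, (1 <= n)%N -> 0 < lambda n < 1)
    (lambda_lower : n%:R * lambda n / ln n%:R @[n --> \oo] --> +oo)
    (lambda_upper : lambda =o_\oo (fun n : nat => 1 / ln n%:R)) (A : R) :
  \forall n \near \oo, [/\ (0 < n)%N, A <= - ln (lambda n) &
    A <= n%:R * lambda n].
Proof.
have lower := (cvgryPge _).1 lambda_lower `|A|.
have upper : \forall n \near \oo, `|lambda n| <= expR (- A) * `|1 / ln n%:R|.
  by have /eqoP := lambda_upper; apply; exact: expR_gt0.
near=> n.
have ne : expR 1 <= n%:R :> R by near: n; exact: nbhs_infty_ger.
have n0 : 0 < n%:R :> R by apply: lt_le_trans ne; exact: expR_gt0.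
have ln1 : 1 <= ln n%:R :> R.
  by rewrite -[leLHS]expRK ler_ln ?posrE ?expR_gt0.
have n1 : (0 < n)%N by rewrite -(ltr_nat R).
have /andP[lam0 lam1] := lambda01 n n1.
have ln0 : 0 < ln n%:R :> R by lra.
split=> //.
- have : `|lambda n| <= expR (- A) * `|1 / ln n%:R| by near: n.
  rewrite (ger0_norm (ltW lam0)) ger0_norm ?divr_ge0 ?(ltW ln0)// => h.
  rewrite lerNr -[leRHS]expRK ler_ln ?posrE ?expR_gt0//.
  apply: (le_trans h); rewrite ler_piMr ?expR_ge0//.
  by rewrite div1r invf_le1.
- have : `|A| <= n%:R * lambda n / ln n%:R by near: n; exact: lower.
  rewrite ler_pdivlMr// => h; apply: (le_trans (ler_norm A)); apply: le_trans h.
  by rewrite ler_peMr.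
Unshelve. all: by end_near. Qed.

Lemma toeplitz_of_fourier_coef (f : R -> R) n (S : 'M[R]_n) :
  (forall i j : 'I_n, ((S i j)%:C)%C = fourier_coef f (j%:Z - i%:Z)) ->
  toeplitz_of f S.
Proof.
move=> SE i j; have := SE i j; rewrite /fourier_coef => -[-> _].
by apply: eq_Rintegral => u _; rewrite /cosw intrB.
Qed.

End scale.

Section upper_bound.
Context {R : realType}.

(** The grid step is negligible with respect to the length of an interval, so that
    hardly any signal is lost, whereas the number of windows has the logarithm
    [- ln (lambda n)] up to lower order terms. *)
Lemma scan_detects (lambda : nat -> R) (f : R -> R) (m M : R)
    (Sigma : forall n, 'M[R]_n)
    (lambda01 : forall n, (1 <= n)%N -> 0 < lambda n < 1)
    (lambda_lower : n%:R * lambda n / ln n%:R @[n --> \oo] --> +oo)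
    (lambda_upper : lambda =o_\oo (fun n : nat => 1 / ln n%:R))
    (f_cont : {within `[- 2^-1, 2^-1[, continuous f})
    (m_gt0 : 0 < m) (f_ge : forall u, freq_dom u -> m <= f u)
    (f_le : forall u, freq_dom u -> f u <= M)
    (SigmaE : forall n, toeplitz_of f (Sigma n))
    (Sigma_cov : forall n, (1 <= n)%N -> is_covariance_mx (Sigma n))
    (alpha : R) (alpha01 : 0 < alpha < 1) :
  exists Phi : forall n, test R n,
      asymptotic_level Phi Sigma alpha /\
      forall c : R, 1 < c ->
        (limn_esup (fun n => type2_error (Phi n) (Sigma n)
                      (c * detection_rate f lambda n) (lambda n))
         <= alpha%:E)%E.
Proof.
have /andP[al0 al1] := alpha01.
have bf := bounded_mfun_spectral_density f_cont f_ge f_le.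
have f00 : 0 < f 0 := lt_le_trans m_gt0 (f_ge 0 freq_dom0).
pose w n := Num.truncn (n%:R * lambda n).
pose s n := (Num.truncn (n%:R * lambda n / - ln (lambda n))).+1.
pose K n := (n %/ s n + 2)%N.
pose V n k : 'I_n -> R := @window R (s n) (w n) k n.
pose sg n k := quad (Sigma n) (V n k) + 1.
exists (fun n => scan_test (K n) (V n)
  (fun k => Num.sqrt (2 * sg n k * ln (2 * (K n)%:R / alpha)))).
split.
  apply: limn_esup_le_near; near=> n.
  have n1 : (0 < n)%N by near: n; exact: nbhs_infty_gt.
  apply: scan_test_type1 => //.
  - exact: Sigma_cov.
  - by rewrite /K addn2.
  - by move=> k; rewrite /sg ltr_wpDl// quad_ge0//; exact: Sigma_cov.
  - by move=> k; rewrite /sg lerDl.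
move=> c c1; have c0 : 0 < c by lra.
have fc : f 0 < c * f 0 by rewrite ltr_pMl.
have [B B0 fB] := spectral_density_majorant f_cont f_le fc.
have [A AP] := scan_slack c1 f00 B0 alpha01.
have scale := scale_asymptotics lambda01 lambda_lower lambda_upper (Num.max A 1).
apply: limn_esup_le_near; apply: filterS scale => n [n1].
rewrite !ge_max => /andP[AL L1] /andP[AX X1].
have /andP[lam0 lam1] := lambda01 n n1.
have cS := Sigma_cov n n1.
apply: ge_ereal_sup => _ [_ [delta [[a [b [a0 ab b1 bal ->]]] hdelta ->]]].
have s0 : (0 < s n)%N by [].
have [k kK kov] := window_overlap delta n1 s0 a0 ab b1 bal.
have sg0 : 0 < sg n k by rewrite /sg ltr_wpDl// quad_ge0.
have alE : expR (- (Num.sqrt (2 * sg n k * ln alpha^-1) ^+ 2 / (2 * sg n k))) = alpha.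
  have sg2 : 0 < 2 * sg n k by rewrite mulr_gt0.
  rewrite sqr_sqrtr; last first.
    by rewrite mulr_ge0 ?(ltW sg2)// ln_ge0// invf_ge1 ?ltW.
  by rewrite mulrAC mulfV ?gt_eqF// mul1r expRN lnK ?posrE ?invr_gt0// invrK.
rewrite -[X in (_ <= X%:E)%E]alE.
apply: (scan_test_type2 cS kK sg0) => //.
- by rewrite lerDl.
apply: (le_trans _ kov).
apply: (le_trans (AP n (lambda n) lam0 AL AX (sg n k) sg0 _)).
  rewrite lerD2r /V.
  pose q := minn (k * s n + w n) n; pose p := minn (k * s n) q.
  have pq : (p <= q)%N by exact: geq_minr.
  have qn : (q <= n)%N by exact: geq_minr.
  rewrite (_ : @window R _ _ _ n = fun i : 'I_n => indicator p q i); last first.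
    apply/funext => i; rewrite /window /indicator /p /q; congr (nat_of_bool _)%:R.
    have hi := ltn_ord i.
    rewrite leq_min hi andbT geq_min.
    case: (ltnP i (k * s n + w n)) => h; last by rewrite !andbF.
    by rewrite !andbT geq_min [(n <= i)%N]leqNgt hi orbF [(k * s n + w n <= i)%N]leqNgt h orbF.
  apply: (le_trans (quad_indicator_le bf (SigmaE n) B0 fB pq qn)).
  rewrite lerD2r ler_pM2l ?mulr_gt0// ler_nat.
  rewrite leq_subLR /p; have [h|/ltnW h] := leqP (k * s n) q.
    exact: geq_minl.
  exact: leq_addr.
rewrite ler_wpM2r//; apply: le_trans hdelta.
rewrite ler_wpM2l ?(ltW c0)// /detection_rate ler_wsqrtr//.
by rewrite le_eqVlt; apply/orP; left; apply/eqP; congr (_ / _); ring.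
Unshelve. all: by end_near. Qed.

End upper_bound.

(** * Mixtures of Gaussian shifts *)

Section bayes_risk.
Context {R : realType}.

Variables n N : nat.

Local Notation P := (std_gaussian n \x std_gaussian N)%E.
Local Notation Omega := (n.-tuple R * N.-tuple R)%type.

(** The likelihood ratios, their products and their exponentially weighted
    versions all have this form, hence explicit integrals. *)
Definition exp_affine (u : 'I_n -> R) (v : 'I_N -> R) (b : R) (z : Omega) : R :=
  expR (dot u (tnth z.1) + dot v (tnth z.2) + b).

Lemma measurable_exp_affine u v b : measurable_fun setT (exp_affine u v b).
Proof.
apply: measurableT_comp => //; apply: measurable_funD => //.
apply: measurable_funD.
- exact: measurableT_comp (measurable_dot u) measurable_fst.
- exact: measurableT_comp (measurable_dot v) measurable_snd.
Qed.

Lemma integral_exp_affine u v b :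
  (\int[P]_z (exp_affine u v b z)%:E = (expR ((dot u u + dot v v) / 2 + b))%:E)%E.
Proof.
rewrite fubini_tonelli1/=; first last.
- by move=> z; rewrite lee_fin expR_ge0.
- by apply/measurable_EFinP; exact: measurable_exp_affine.
transitivity (\int[std_gaussian n]_x
    (expR (dot u (tnth x) + (dot v v / 2 + b)))%:E)%E.
  apply: eq_integral => x _; rewrite /fubini_F /exp_affine/=.
  under eq_integral do rewrite addrAC addrC.
  by rewrite integral_exp_dot; congr (expR _)%:E; ring.
by rewrite integral_exp_dot; congr (expR _)%:E; ring.
Qed.

Lemma integrable_exp_affine u v b : P.-integrable setT (EFin \o exp_affine u v b).
Proof.
apply/integrableP; split.
  by apply/measurable_EFinP; exact: measurable_exp_affine.
under eq_integral do rewrite /= ger0_norm ?expR_ge0//.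
by rewrite integral_exp_affine ltry.
Qed.

Lemma Rintegral_exp_affine u v b :
  \int[P]_z exp_affine u v b z = expR ((dot u u + dot v v) / 2 + b).
Proof. by rewrite /Rintegral integral_exp_affine. Qed.

Lemma integrable_indic_exp_affine (B : set (n.-tuple R)) u v b : measurable B ->
  P.-integrable setT (EFin \o (fun z => \1_B z.1 * exp_affine u v b z)).
Proof.
move=> mB; apply: le_integrable (integrable_exp_affine u v b) => //.
  apply/measurable_EFinP; apply: measurable_funM; last exact: measurable_exp_affine.
  exact: measurableT_comp (measurable_indic mB) measurable_fst.
move=> z _; rewrite /= lee_fin normrM ler_piMl// indicE.
by case: (_ \in _); rewrite ?normr1 ?normr0.
Qed.

(** The density in the second variable integrates to 1, and the Cameron-Martin
    formula applies to the first variable. *)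
Lemma Rintegral_indic_tilt (B : set (n.-tuple R)) u v : measurable B ->
  \int[P]_z (\1_B z.1 * exp_affine u v (- ((dot u u + dot v v) / 2)) z) =
  fine (std_gaussian n (shift_tuple u @^-1` B)).
Proof.
move=> mB; congr fine.
have mB' : measurable_fun setT (fun z : Omega => (\1_B z.1 : R)).
  exact: measurableT_comp (measurable_indic mB) measurable_fst.
rewrite fubini_tonelli1/=; first last.
- by move=> z; rewrite lee_fin mulr_ge0 ?expR_ge0.
- apply/measurable_EFinP; apply: measurable_funM => //; exact: measurable_exp_affine.
transitivity (\int[std_gaussian n]_x ((\1_B x)%:E * (tilt u x)%:E))%E.
  apply: eq_integral => x _; rewrite /fubini_F /exp_affine/=.
  under eq_integral => y _.
    rewrite (_ : _ * _ = \1_B x * tilt u x *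
        expR (dot v (tnth y) + (- (dot v v / 2)))); last first.
      by rewrite -mulrA /tilt -expRD; congr (_ * expR _); ring.
    rewrite EFinM; over.
  rewrite ge0_integralZl//; first last.
  - by rewrite lee_fin mulr_ge0 ?expR_ge0.
  - apply/measurable_EFinP; apply: measurableT_comp => //.
    by apply: measurable_funD => //; exact: measurable_dot.
  by rewrite integral_exp_dot subrr expR0 mule1 EFinM.
rewrite -(@ge0_integral_std_gaussian_shift _ _ u (fun x => (\1_B x)%:E)).
- transitivity (\int[std_gaussian n]_x (\1_(shift_tuple u @^-1` B) x)%:E)%E.
    by apply: eq_integral => x _; rewrite !indicE.
  rewrite integral_indic ?setIT//.
  by rewrite -[_ @^-1` _]setTI; exact: measurable_shift_tuple.
- by apply/measurable_EFinP; exact: measurable_indic.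
- by move=> x; rewrite lee_fin.
Qed.

End bayes_risk.

Section second_moment.
Context {R : realType}.
Local Notation PP n N := (@std_gaussian R n \x @std_gaussian R N)%E.

(** Let [L] be the average of the truncated ratios [U k].  The inequality
    [beta (1 - L) <= eta + (1 - L)^2 / (4 eta)], in which the square is expanded,
    becomes a statement without [U]: in the linear terms [U k] lies between
    [a k - c k] and [a k], and in the quadratic term its products are at most
    [d k] on the diagonal and [a k * a l] elsewhere. *)
Lemma truncated_average_bound N (a c d U : 'I_N -> R) (beta eta : R) :
  (forall k, 0 <= U k <= a k) -> (forall k, a k - c k <= U k) ->
  (forall k, U k ^+ 2 <= d k) -> 0 <= beta <= 1 -> 0 < eta ->
  4 * eta * beta + 2 * (N%:R^-1 * \sum_k a k) <=
  4 * eta * (beta * (N%:R^-1 * \sum_k a k)) + (4 * eta ^+ 2 + 1) +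
  (2 * (N%:R^-1 * \sum_k c k) +
   N%:R^-1 ^+ 2 * \sum_k \sum_l (if l == k then d k else a k * a l)).
Proof.
move=> U0a acU Ud /andP[b0 b1] eta0.
pose L := N%:R^-1 * \sum_k U k.
have iN0 : 0 <= N%:R^-1 :> R by rewrite invr_ge0.
have La : L <= N%:R^-1 * \sum_k a k.
  by rewrite ler_wpM2l// ler_sum// => k _; have /andP[] := U0a k.
have acL : N%:R^-1 * \sum_k a k - N%:R^-1 * \sum_k c k <= L.
  by rewrite -mulrBr ler_wpM2l// -sumrB ler_sum.
have LW : L ^+ 2 <= N%:R^-1 ^+ 2 *
    \sum_k \sum_l (if l == k then d k else a k * a l).
  rewrite exprMn ler_wpM2l ?sqr_ge0// expr2 big_distrlr/=.
  apply: ler_sum => k _; apply: ler_sum => l _; case: eqP => [->|_].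
    by rewrite -expr2.
  by have /andP[? ?] := U0a k; have /andP[? ?] := U0a l; exact: ler_pM.
have key : 4 * eta * (beta * (1 - L)) <= 4 * eta ^+ 2 + (1 - L) ^+ 2.
  have [L1|L1] := lerP 0 (1 - L).
    have : beta * (1 - L) <= 1 - L by rewrite ler_piMl.
    have := sqr_ge0 (2 * eta - (1 - L)); move: eta0; clear; nra.
  have : beta * (1 - L) <= 0 by rewrite mulr_ge0_le0// ltW.
  have := sqr_ge0 (1 - L); have := sqr_ge0 eta; move: eta0; clear; nra.
have ebL : eta * (beta * L) <= eta * (beta * (N%:R^-1 * \sum_k a k)).
  by rewrite ler_pM2l// ler_wpM2l.
move: key LW ebL acL; set a' := N%:R^-1 * _; set c' := N%:R^-1 * \sum_k c k.
set W := N%:R^-1 ^+ 2 * _; move=> key LW ebL acL.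
have -> : 4 * eta * beta = 4 * eta * (beta * (1 - L)) + 4 * (eta * (beta * L)) by ring.
have -> : 4 * eta * (beta * a') = 4 * (eta * (beta * a')) by ring.
have h : (1 - L) ^+ 2 = 1 - 2 * L + L ^+ 2 by ring.
rewrite h in key; lra.
Qed.

(** Average the likelihood ratios of the [N] orthogonal shifts [(th k, rs k)], of
    squared length [T], each one truncated where its linear form exceeds
    [T (1 + r)].  The truncation lowers the mean by at most [exp (- r^2 T / 2)],
    and it lowers the diagonal part of the second moment from [exp T / N] to at
    most [exp (T (1/2 + r)) / N]; the other part is at most 1 by orthogonality.  So
    the average is close to 1 in mean square.  The test depends on the first
    Gaussian vector, whereas the shifts [rs k] act on an independent one and
    serve to make the total shifts orthogonal. *)
Lemma mixture_test_bound n N (th : 'I_N -> 'I_n -> R) (rs : 'I_N -> 'I_N -> R)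
    (T r eta b : R) (B : set (n.-tuple R)) :
  (0 < N)%N -> 0 <= r <= 1 -> 0 <= T -> 0 < eta -> measurable B ->
  (forall k l, dot (th k) (th l) + dot (rs k) (rs l) = T * (k == l)%:R) ->
  (forall k, fine (std_gaussian n (shift_tuple (th k) @^-1` B)) <= b) ->
  fine (std_gaussian n B) <= b + eta +
    (expR (T * (2^-1 + r)) / N%:R + 2 * expR (- (r ^+ 2 * T / 2))) / (4 * eta).
Proof.
move=> N0 /andP[r0 r1] T0 eta0 mB gram pb.
have N0' : 0 < N%:R :> R by rewrite ltr0n.
have gramkk k : dot (th k) (th k) + dot (rs k) (rs k) = T.
  by rewrite gram eqxx mulr1.
(* The likelihood ratios are [a k].  The weight of [c k] is at least 1 where
   [a k] is truncated, and that of [d k] is at least 1 where it is not; the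
   exponents [r] and [1 - r] optimise the two resulting bounds. *)
pose ba : R := - (T / 2).
pose a k : n.-tuple R * N.-tuple R -> R := exp_affine (th k) (rs k) ba.
pose bc : R := - (T / 2) - r * (1 + r) * T.
pose c k := exp_affine (fun i => (1 + r) * th k i) (fun i => (1 + r) * rs k i) bc.
pose bd : R := - T + (1 - r) * (1 + r) * T.
pose d k := exp_affine (fun i => (1 + r) * th k i) (fun i => (1 + r) * rs k i) bd.
pose aa k l := exp_affine (fun i => th k i + th l i) (fun i => rs k i + rs l i) (- T).
pose W k l := if l == k then d k else aa k l.
pose X k (z : n.-tuple R * N.-tuple R) := dot (th k) (tnth z.1) + dot (rs k) (tnth z.2).
pose x := T * (1 + r).
pose U k z := if X k z <= x then a k z else 0.
have cE k z : c k z = a k z * expR (r * (X k z - x)).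
  rewrite /c /a /exp_affine !dotZl -expRD; congr expR; rewrite /bc /ba /X /x; ring.
have dE k z : d k z = a k z ^+ 2 * expR ((1 - r) * (x - X k z)).
  by rewrite /d /a /exp_affine !dotZl expr2 -!expRD; congr expR; rewrite /bd /ba /X /x; field.
have aaE k l z : aa k l z = a k z * a l z.
  by rewrite /aa /a /exp_affine !dotDl -expRD; congr expR; rewrite /ba; field.
have a0 k z : 0 <= a k z by exact: expR_ge0.
have point z : 4 * eta * \1_B z.1 + 2 * (N%:R^-1 * \sum_k a k z) <=
  4 * eta * (\1_B z.1 * (N%:R^-1 * \sum_k a k z)) + (4 * eta ^+ 2 + 1) +
  (2 * (N%:R^-1 * \sum_k c k z) + N%:R^-1 ^+ 2 * \sum_k \sum_l W k l z).
  have -> : \sum_k \sum_l W k l z =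
      \sum_k \sum_l (if l == k then d k z else a k z * a l z).
    by apply: eq_bigr => k _; apply: eq_bigr => l _; rewrite /W -aaE; case: eqP.
  apply: (@truncated_average_bound _ _ _ _ (fun k => U k z)) => //.
  - by move=> k; rewrite /U; case: ifP => _; rewrite ?lexx a0.
  - move=> k; rewrite /U cE; case: ifP => Xx.
      by rewrite gerBl mulr_ge0// expR_ge0.
    rewrite subr_le0 ler_peMr// -[leLHS](@expR0 R) ler_expR mulr_ge0// subr_ge0.
    by rewrite ltW// ltNge Xx.
  - move=> k; rewrite /U dE; case: ifP => Xx.
      rewrite ler_peMr ?sqr_ge0// -[leLHS](@expR0 R) ler_expR.
      by rewrite mulr_ge0// subr_ge0.
    by rewrite expr0n/= mulr_ge0 ?sqr_ge0// expR_ge0.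
  - by rewrite indicE; case: (_ \in _); rewrite ?lexx ler01.
pose Bz (z : n.-tuple R * N.-tuple R) : R := \1_B z.1.
pose Ba k z := Bz z * a k z.
have mT : measurable [set: n.-tuple R * N.-tuple R] by exact: measurableT.
pose zn (i : 'I_n) : R := 0; pose zN (i : 'I_N) : R := 0.
have dot0 p (w : 'I_p -> R) : dot (fun=> 0) w = 0.
  by rewrite /dot big1// => i _; rewrite mul0r.
have BzE : Bz = fun z => \1_B z.1 * exp_affine zn zN (- ((dot zn zn + dot zN zN) / 2)) z.
  apply/funext => z; rewrite /Bz /exp_affine /zn /zN.
  by rewrite !(dot0, addr0, mul0r, oppr0) expR0 mulr1.
have iBz : (PP n N).-integrable setT (EFin \o Bz).
  by rewrite BzE; exact: integrable_indic_exp_affine.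
have ia k : (PP n N).-integrable setT (EFin \o a k) by exact: integrable_exp_affine.
have ic k : (PP n N).-integrable setT (EFin \o c k) by exact: integrable_exp_affine.
have iW k l : (PP n N).-integrable setT (EFin \o W k l).
  by rewrite /W; case: eqP => _; exact: integrable_exp_affine.
have iBa k : (PP n N).-integrable setT (EFin \o Ba k) by exact: integrable_indic_exp_affine.
have Ea k : \int[PP n N]_z a k z = 1.
  by rewrite Rintegral_exp_affine gramkk /ba subrr expR0.
have Ec k : \int[PP n N]_z c k z = expR (- (r ^+ 2 * T / 2)).
  by rewrite Rintegral_exp_affine !dotZZ -mulrDr gramkk /bc; congr expR; field.
have Ed k : \int[PP n N]_z d k z <= expR (T * (2^-1 + r)).
  rewrite Rintegral_exp_affine !dotZZ -mulrDr gramkk /bd ler_expR.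
  have : 0 <= T * r ^+ 2 by rewrite mulr_ge0 ?sqr_ge0.
  have -> : (1 + r) ^+ 2 * T / 2 + (- T + (1 - r) * (1 + r) * T) =
    T * (2^-1 + r) - T * r ^+ 2 / 2 by field.
  lra.
have Eaa k l : k != l -> \int[PP n N]_z aa k l z = 1.
  move=> kl; rewrite Rintegral_exp_affine !dotDD.
  have -> : dot (th k) (th k) + 2 * dot (th k) (th l) + dot (th l) (th l) +
    (dot (rs k) (rs k) + 2 * dot (rs k) (rs l) + dot (rs l) (rs l)) =
    (dot (th k) (th k) + dot (rs k) (rs k)) +
    2 * (dot (th k) (th l) + dot (rs k) (rs l)) +
    (dot (th l) (th l) + dot (rs l) (rs l)) by ring.
  by rewrite !gramkk gram (negbTE kl) !mulr0 addr0 -[RHS](@expR0 R); congr expR; field.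
have EBa k : \int[PP n N]_z Ba k z <= b.
  have := Rintegral_indic_tilt (th k) (rs k) mB.
  by rewrite gramkk -/ba -/(a k) => ->.
have EBz : \int[PP n N]_z Bz z = fine (std_gaussian n B).
  rewrite BzE Rintegral_indic_tilt//; congr (fine (_ _)).
  apply/seteqP; split => z /=; rewrite (_ : shift_tuple _ z = z)//;
    by apply: eq_from_tnth => i; rewrite tnth_mktuple addr0.
have iSa : (PP n N).-integrable setT (EFin \o (fun z => \sum_k a k z)).
  exact: integrable_sumr.
have iSc : (PP n N).-integrable setT (EFin \o (fun z => \sum_k c k z)).
  exact: integrable_sumr.
have iSBa : (PP n N).-integrable setT (EFin \o (fun z => \sum_k Ba k z)).
  exact: integrable_sumr.
have iSWk k : (PP n N).-integrable setT (EFin \o (fun z => \sum_l W k l z)).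
  exact: integrable_sumr.
have iSW : (PP n N).-integrable setT (EFin \o (fun z => \sum_k \sum_l W k l z)).
  exact: (integrable_sumr _ _ iSWk).
have iZ C g : (PP n N).-integrable setT (EFin \o g) ->
    (PP n N).-integrable setT (EFin \o (fun z => C * g z)).
  move=> ig; exact: eq_integrable (integrableZl mT C ig).
have iD g h : (PP n N).-integrable setT (EFin \o g) -> (PP n N).-integrable setT (EFin \o h) ->
    (PP n N).-integrable setT (EFin \o (fun z => g z + h z)).
  by move=> ig ih; exact: eq_integrable (integrableD mT ig ih).
(* A constant is a multiple of the exponential of the zero form, so the formulas
   for [exp_affine] apply to it. *)
have cstE C : (fun=> C) = fun z => C * exp_affine zn zN 0 z.
  apply/funext => z; rewrite /exp_affine /zn /zN.
  by rewrite !(dot0, addr0) expR0 mulr1.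
have icst C : (PP n N).-integrable setT (EFin \o (fun=> C)).
  by rewrite cstE; apply: (iZ); exact: integrable_exp_affine.
have Ecst C : \int[PP n N]_z C = C.
  rewrite -[LHS]/(Rintegral _ _ (fun=> C)) cstE RintegralZl//; last exact: integrable_exp_affine.
  rewrite Rintegral_exp_affine /zn /zN.
  by rewrite !(dot0, addr0, mul0r) expR0 mulr1.
have ESa : \int[PP n N]_z (\sum_k a k z) = N%:R.
  rewrite (Rintegral_sum _ mT ia).2 (eq_bigr (fun=> 1)) => [|k _]; last exact: Ea.
  by rewrite sumr_const card_ord.
have ESc : \int[PP n N]_z (\sum_k c k z) = N%:R * expR (- (r ^+ 2 * T / 2)).
  rewrite (Rintegral_sum _ mT ic).2 (eq_bigr _ (fun k _ => Ec k)).
  by rewrite sumr_const card_ord -[_ *+ N]mulr_natl.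
have ESBa : \int[PP n N]_z (\sum_k Ba k z) <= N%:R * b.
  rewrite (Rintegral_sum _ mT iBa).2.
  apply: le_trans (ler_sum _ (fun k _ => EBa k)) _.
  by rewrite sumr_const card_ord -[_ *+ N]mulr_natl.
have ESW : \int[PP n N]_z (\sum_k \sum_l W k l z) <=
    N%:R * (expR (T * (2^-1 + r)) + N%:R).
  rewrite (Rintegral_sum _ mT iSWk).2.
  apply: (@le_trans _ _ (\sum_(k < N) (expR (T * (2^-1 + r)) + N%:R))); last first.
    by rewrite sumr_const card_ord -[_ *+ N]mulr_natl.
  apply: ler_sum => k _; rewrite (Rintegral_sum _ mT (iW k)).2.
  rewrite (bigD1 k)//=; apply: lerD; first by rewrite /W eqxx Ed.
  apply: (@le_trans _ _ (\sum_(l < N) 1)); last by rewrite sumr_const card_ord.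
  rewrite [leRHS](bigID (predC1 k))/= ler_wpDr ?sumr_ge0//.
  by apply: ler_sum => l lk; rewrite /W (negbTE lk) Eaa// eq_sym.
have : \int[PP n N]_z (4 * eta * Bz z + 2 * N%:R^-1 * \sum_k a k z) <=
   \int[PP n N]_z (4 * eta * N%:R^-1 * \sum_k Ba k z + (4 * eta ^+ 2 + 1) +
     (2 * N%:R^-1 * \sum_k c k z + N%:R^-1 ^+ 2 * \sum_k \sum_l W k l z)).
  apply: le_Rintegral => //.
  - by apply: (iD); exact: (iZ).
  - by apply: (iD); [apply: (iD) => //; exact: (iZ)|apply: (iD); exact: (iZ)].
  move=> z _; have := point z.
  have -> : 2 * N%:R^-1 * \sum_k a k z = 2 * (N%:R^-1 * \sum_k a k z) by rewrite mulrA.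
  have -> : 4 * eta * N%:R^-1 * \sum_k Ba k z =
      4 * eta * (\1_B z.1 * (N%:R^-1 * \sum_k a k z)).
    by rewrite /Ba -mulr_sumr /Bz; ring.
  by have -> : 2 * N%:R^-1 * \sum_k c k z = 2 * (N%:R^-1 * \sum_k c k z) by rewrite mulrA.
have iZSa C : (PP n N).-integrable setT (EFin \o (fun z => C * \sum_k a k z)) by exact: (iZ).
have iZSc C : (PP n N).-integrable setT (EFin \o (fun z => C * \sum_k c k z)) by exact: (iZ).
have iZSBa C : (PP n N).-integrable setT (EFin \o (fun z => C * \sum_k Ba k z)) by exact: (iZ).
have iZSW C : (PP n N).-integrable setT (EFin \o (fun z => C * \sum_k \sum_l W k l z)).
  exact: (iZ).
rewrite RintegralD//; last exact: (iZ).
rewrite [X in _ <= X]RintegralD//; [|by apply: (iD)|by apply: (iD)].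
rewrite [X in _ <= X + _]RintegralD// [X in _ <= _ + X]RintegralD//.
rewrite !RintegralZl// EBz ESa ESc Ecst.
rewrite mulfVK ?gt_eqF// => h.
have h1 : 4 * eta * N%:R^-1 * \int[PP n N]_z (\sum_k Ba k z) <= 4 * eta * b.
  rewrite -mulrA ler_pM2l ?mulr_gt0// -ler_pdivlMl ?invr_gt0// invrK//.
have h2 : N%:R^-1 ^+ 2 * \int[PP n N]_z (\sum_k \sum_l W k l z) <=
    expR (T * (2^-1 + r)) / N%:R + 1.
  have -> : expR (T * (2^-1 + r)) / N%:R + 1 =
      N%:R^-1 ^+ 2 * (N%:R * (expR (T * (2^-1 + r)) + N%:R)).
    by field; rewrite gt_eqF.
  by rewrite ler_wpM2l ?sqr_ge0.
rewrite [2 * N%:R^-1 * _]mulrA mulfVK ?gt_eqF// in h.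
rewrite -(ler_pM2l (mulr_gt0 (ltr0n _ 4 : 0 < 4) eta0)).
have -> : 4 * eta * (b + eta + (expR (T * (2^-1 + r)) / N%:R +
    2 * expR (- (r ^+ 2 * T / 2))) / (4 * eta)) =
  4 * eta * b + 4 * eta ^+ 2 + expR (T * (2^-1 + r)) / N%:R +
    2 * expR (- (r ^+ 2 * T / 2)).
  by field; rewrite !gt_eqF.
move: h h1 h2; set I1 := 4 * eta * N%:R^-1 * _; set I2 := N%:R^-1 ^+ 2 * _.
set p := expR _ / _; set q := expR _; set g := fine _.
move: I1 I2 p q g; clear => I1 I2 p q g h h1 h2; lra.
Qed.

End second_moment.

(** * A prior that no test detects *)

Section least_favourable_prior.
Context {R : realType}.

Definition combine n N (x : 'I_N -> R) (th : 'I_N -> 'I_n -> R) (i : 'I_n) : R :=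
  \sum_k x k * th k i.

Lemma dot_combine n N (x : 'I_N -> R) (th : 'I_N -> 'I_n -> R) :
  dot (combine x th) (combine x th) =
  \sum_k \sum_l x k * x l * dot (th k) (th l).
Proof.
rewrite /dot /combine; under eq_bigr do rewrite big_distrlr/=.
rewrite exchange_big; apply: eq_bigr => k _ /=.
rewrite exchange_big; apply: eq_bigr => l _ /=.
by rewrite mulr_sumr; apply: eq_bigr => i _; rewrite mulrACA.
Qed.

(** The matrix with entries [T * (k == l) - dot (th k) (th l)] is positive
    semidefinite, hence the Gram matrix of the rows of a square root. *)
Lemma gram_completion n N (th : 'I_N -> 'I_n -> R) (T : R) :
  (forall x, dot (combine x th) (combine x th) <= T * dot x x) ->
  exists rs : 'I_N -> 'I_N -> R,
    forall k l, dot (th k) (th l) + dot (rs k) (rs l) = T * (k == l)%:R.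
Proof.
move=> thT.
pose G : 'M[R]_N := \matrix_(k, l) (T * (k == l)%:R - dot (th k) (th l)).
have cG : is_covariance_mx G.
  split; first by apply/matrixP => k l; rewrite !mxE eq_sym dotC.
  move=> v; rewrite quad_mulmx; set x := fun i => v 0 i.
  have -> : quad G x = T * dot x x - dot (combine x th) (combine x th).
    rewrite dot_combine /quad /dot mulr_sumr -sumrB; apply: eq_bigr => k _.
    under eq_bigr do rewrite mxE mulrBr.
    rewrite sumrB; congr (_ - _).
    rewrite (bigD1 k)//= eqxx mulr1 big1 ?addr0; first by rewrite mulrC.
    by move=> l lk; rewrite eq_sym (negbTE lk) !mulr0.
  by rewrite subr_ge0 thT.
exists (fun k j => mx_root G k j) => k l.
have : (mx_root G *m (mx_root G)^T) k l = G k l by rewrite mx_rootP.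
rewrite !mxE; under eq_bigr do rewrite mxE.
by rewrite /dot => ->; rewrite addrC subrK.
Qed.

Lemma mx_root_unit n (S : 'M[R]_n) (m : R) : is_covariance_mx S -> 0 < m ->
  (forall v, m * dot v v <= quad S v) -> mx_root S \in unitmx.
Proof.
move=> cS m0 mS; rewrite -row_free_unit; apply: inj_row_free => v vA.
have : m * dot (fun i => v 0 i) (fun i => v 0 i) <= 0.
  apply: (le_trans (mS _)); rewrite -quad_mulmx -{1}(mx_rootP cS).
  by rewrite mulmxA vA !mul0mx mxE.
rewrite pmulr_rle0// => vv; apply/rowP => i; rewrite mxE.
have : v 0 i * v 0 i <= 0.
  apply: le_trans vv; rewrite /dot (bigD1 i)//= lerDl.
  by apply: sumr_ge0 => j _; rewrite -expr2 sqr_ge0.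
by rewrite -expr2 real_exprn_even_le0 ?num_real// => /eqP.
Qed.

Lemma gaussian_law_shift n (S : 'M[R]_n) (mu : 'cV[R]_n) (B : set (n.-tuple R)) :
  mx_root S \in unitmx ->
  gaussian_law mu S B =
  std_gaussian n (shift_tuple (fun j => (invmx (mx_root S) *m mu) j 0) @^-1`
    (affine_map 0 (mx_root S) @^-1` B)).
Proof.
move=> uA; congr (std_gaussian n _).
have shiftE z : affine_map mu (mx_root S) z = affine_map 0 (mx_root S)
    (shift_tuple (fun j => (invmx (mx_root S) *m mu) j 0) z).
  apply: eq_from_tnth => i; rewrite !tnth_mktuple.
  under [X in _ = _ + X]eq_bigr do rewrite tnth_mktuple mulrDr.
  rewrite big_split/= [X in _ = X + _]mxE add0r addrC; congr (_ + _).
  have := congr1 (fun M : 'cV[R]_n => M i 0) (mulKVmx uA mu).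
  by rewrite mxE.
by apply/seteqP; split => z /=; rewrite shiftE.
Qed.

Lemma dot_blocks_indicator n (M N : nat) (v : 'I_n -> R) (x : 'I_N -> R) :
  dot v (fun i => blocks M x i) =
  \sum_k x k * dot v (fun i => indicator (k * M) (k.+1 * M) i).
Proof.
rewrite /dot /blocks; under eq_bigr do rewrite mulr_sumr.
rewrite exchange_big; apply: eq_bigr => k _ /=.
by rewrite mulr_sumr; apply: eq_bigr => i _; rewrite mulrCA.
Qed.

(** The signal of height [delta] on block [k], in coordinates where the noise is
    standard Gaussian. *)
Definition whitened_block n (S : 'M[R]_n) (delta : R) (M : nat) (k : nat) (j : 'I_n) : R :=
  (invmx (mx_root S) *m (delta *: \col_(i < n) indicator (k * M) (k.+1 * M) i)) j 0.

(** Let [y] be the combination of the whitened blocks, [A] the square root of [S]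
    and [v = y A^-1].  Then [quad S v] is [dot y y], and so is the product of [v]
    with the step function [A y].  Hence [quad_blocks_lower_bound] reads
    [2 * dot y y - W <= dot y y], which is the bound by [W]. *)
Lemma whitened_gram_le (f : R -> R) (fmin c B delta : R) (M N n : nat)
    (S : 'M[R]_n) (x : 'I_N -> R) :
  bounded_mfun f -> toeplitz_of f S -> is_covariance_mx S -> 0 < fmin ->
  (forall u, freq_dom u -> fmin <= f u) -> 0 <= B ->
  (forall u, freq_dom u -> (f u)^-1 <= c + B * gap u) ->
  (0 < M)%N -> (N * M <= n)%N -> mx_root S \in unitmx ->
  dot (combine x (fun k : 'I_N => whitened_block S delta M k))
      (combine x (fun k : 'I_N => whitened_block S delta M k)) <=
  delta ^+ 2 * (c * M%:R + 4 * B) * dot x x.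
Proof.
move=> bf SE cS fmin0 fm B0 fV M0 NMn uA.
set A := mx_root S in uA *; set y := combine _ _.
pose yr : 'rV[R]_n := \row_j y j.
pose vr := yr *m invmx A; pose v i := vr 0 i.
have vA j : mxform A v j = y j.
  have := congr1 (fun M : 'rV[R]_n => M 0 j) (mulmxKV uA yr).
  by rewrite mxE => /= h; rewrite /mxform /v h mxE.
have quadv : quad S v = dot y y.
  rewrite -(mx_rootP cS) -dot_mxform -/A.
  by apply: eq_bigr => j _; rewrite vA.
pose x' k := delta * x k.
have dvw : dot v (fun i => blocks M x' i) = dot y y.
  rewrite dot_blocks_indicator.
  have th_v (k : 'I_N) : dot y (whitened_block S delta M k) =
      delta * dot v (fun i => indicator (k * M) (k.+1 * M) i).
    have vAE j : y j = mxform A v j by rewrite vA.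
    rewrite /dot; under eq_bigr do rewrite vAE /mxform mulr_suml.
    rewrite exchange_big mulr_sumr; apply: eq_bigr => i _ /=.
    have := congr1 (fun M : 'cV[R]_n => M i 0)
      (mulKVmx uA (delta *: \col_(i < n) indicator (k * M) (k.+1 * M) i)).
    rewrite mxE !mxE => h; under eq_bigr do rewrite -mulrA.
    by rewrite -mulr_sumr h mulrCA.
  transitivity (\sum_k x k * dot y (whitened_block S delta M k)).
    by apply: eq_bigr => k _; rewrite th_v /x'; ring.
  rewrite /dot; under eq_bigr do rewrite mulr_sumr.
  rewrite exchange_big; apply: eq_bigr => j _ /=.
  by rewrite {2}/y /combine mulr_sumr; apply: eq_bigr => k _; rewrite mulrCA.
have := quad_blocks_lower_bound v x' bf SE fmin0 fm B0 fV M0 NMn.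
rewrite dvw quadv.
have -> : dot x' x' = delta ^+ 2 * dot x x by exact: dotZZ.
rewrite mulrA [_ * delta ^+ 2]mulrC; lra.
Qed.

End least_favourable_prior.

Section lower_bound.
Context {R : realType}.

(** The right end of the interval is the first design point after the block; as
    [M <= n lam < M + 1], the interval then contains the block exactly. *)
Lemma block_interval (n : nat) (lam : R) (k : nat) :
  (0 < n)%N -> 0 < lam ->
  let M := Num.truncn (n%:R * lam) in (k.+1 * M < n)%N ->
  exists2 I, intervals lam I &
    indic_vec n I = \col_(i < n) indicator (k * M) (k.+1 * M) i.
Proof.
move=> n0 lam0 M kMn.
have n0' : 0 < n%:R :> R by rewrite ltr0n.
have /andP[M1 M2] := truncn_itv (mulr_ge0 (ltW n0') (ltW lam0)); rewrite -/M in M1 M2.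
pose b : R := (k.+1 * M).+1%:R / n%:R.
have nb : b * n%:R = (k.+1 * M).+1%:R by rewrite divfK// gt_eqF.
have nbl : (b - lam) * n%:R = (k.+1 * M).+1%:R - n%:R * lam.
  by rewrite mulrBl nb [lam * _]mulrC.
exists `[b - lam, b[%classic.
  exists (b - lam), b; split=> //.
  - rewrite -(pmulr_lge0 _ n0') nbl subr_ge0 (le_trans (ltW M2))//.
    by rewrite ler_nat ltnS mulSn leq_addr.
  - by rewrite ltrBlDr ltrDl.
  - by rewrite ler_pdivrMr// mul1r ler_nat.
  - by rewrite subKr.
apply/colP => i; rewrite !mxE indicE /indicator; congr (nat_of_bool _)%:R.
apply/idP/idP.
  rewrite inE/= in_itv/= ler_pdivlMr// ltr_pdivrMr// nb nbl ltr_nat ltnS.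
  move=> /andP[h ->]; rewrite andbT.
  rewrite -ltnS -(ltr_nat R); move: h; rewrite mulSn.
  rewrite -addnS natrD lerBlDr => h.
  have : (k * M).+1%:R < i.+2%:R :> R.
    rewrite -[i.+2%:R]natr1; move: h M2; rewrite -[M.+1%:R]natr1; lra.
  by rewrite !ltr_nat ltnS.
move=> /andP[h1 h2]; rewrite inE/= in_itv/= ler_pdivlMr// ltr_pdivrMr// nb nbl.
rewrite ltr_nat ltnS h2 andbT mulSn -addnS natrD lerBlDr.
have : (k * M).+1%:R <= i.+1%:R :> R by rewrite ler_nat.
move: M1; lra.
Qed.

Lemma measurable_test n (Phi : test R n) b : measurable [set y | Phi y = b].
Proof.
have mf : measurable_fun setT Phi by [].
by have := mf measurableT [set b]; rewrite setTI; apply.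
Qed.

Lemma expRN_le (y : R) : 0 < y -> expR (- y) <= y^-1.
Proof.
move=> y0; rewrite expRN lef_pV2 ?posrE ?expR_gt0//.
by apply: le_trans (expR_ge1Dx y); rewrite lerDr.
Qed.

Lemma block_count (n : nat) (lam : R) : 0 < lam -> 3 <= - ln lam -> 1 <= n%:R * lam ->
  let M := Num.truncn (n%:R * lam) in let N := (n.-1 %/ M)%N in
  [/\ (0 < M)%N, (0 < N)%N & (2 * lam)^-1 <= N%:R].
Proof.
move=> lam0 L3; set X := n%:R * lam => X1 M N.
have X0 : 0 < X by lra.
have /andP[M1 M2] := truncn_itv (ltW X0); rewrite -/M in M1 M2.
have M0 : (0 < M)%N.
  by rewrite -ltnS -(ltr_nat R); apply: le_lt_trans M2.
have n0' : 0 < n%:R :> R by move: X0; rewrite /X pmulr_lgt0.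
have n0 : (0 < n)%N by rewrite -(ltr_nat R).
have lam4 : lam <= 4^-1.
  have -> : lam = expR (- - ln lam) by rewrite opprK lnK.
  rewrite expRN lef_pV2 ?posrE ?expR_gt0//.
  by apply: le_trans (expR_ge1Dx _); lra.
have X4 : X <= n%:R / 4 by rewrite ler_wpM2l// ltW.
have NX : n%:R - 1 < (N%:R + 1) * X.
  have : (n.-1 < N.+1 * M)%N by rewrite /N ltn_ceil.
  rewrite -(ltr_nat R) natrM -[N.+1%:R]natr1 => h.
  have -> : n%:R - 1 = n.-1%:R :> R by rewrite -[in LHS](prednK n0) -natr1 addrK.
  by apply: (lt_le_trans h); rewrite ler_wpM2l.
have N2 : (2 * lam)^-1 <= N%:R.
  have -> : (2 * lam)^-1 = (n%:R / 2) / X.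
    by rewrite /X; field; rewrite !gt_eqF.
  rewrite ler_pdivrMr//; move: NX; rewrite mulrDl mul1r.
  have : n%:R / 4 + n%:R / 4 = n%:R / 2 :> R by field.
  have : 4 <= n%:R :> R by lra.
  lra.
split=> //; rewrite -(ltr_nat R); apply: lt_le_trans N2.
by rewrite invr_gt0 mulr_gt0.
Qed.

(** The squared length [T] of the shifts is [2 L] times [(1 + c) / 2], which leaves
    room for the error terms of the Gram bound.  With this [r] one has
    [T (1/2 + r) = L - L (1 - c) / 4], so the diagonal part of the second moment
    is at most [2 exp (- L (1 - c) / 4)]. *)
Lemma prior_slack (c f0 B e : R) : 0 < c < 1 -> 0 < f0 -> 0 <= B -> 0 < e ->
  exists A : R, forall (n : nat) (lam : R), 0 < lam -> A <= - ln lam ->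
    A <= n%:R * lam ->
    let L := - ln lam in let M := Num.truncn (n%:R * lam) in
    let N := (n.-1 %/ M)%N in
    let T := (1 + c) * L in let r := (1 - c) / (4 * (1 + c)) in
    [/\ (0 < M)%N, (0 < N)%N,
      c ^+ 2 * (2 * f0 * L / (n%:R * lam)) * ((c * f0)^-1 * M%:R + 4 * B) <= T &
      (expR (T * (2^-1 + r)) / N%:R + 2 * expR (- (r ^+ 2 * T / 2))) / (4 * e) <= e].
Proof.
move=> /andP[c0 c1] f00 B0 e0.
pose r := (1 - c) / (4 * (1 + c)).
have c1' : 0 < 1 + c by lra.
have r0 : 0 < r by rewrite divr_gt0 ?mulr_gt0//; lra.
pose a := (1 - c) / 4; pose b := r ^+ 2 * (1 + c) / 2.
have a0 : 0 < a by rewrite divr_gt0//; lra.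
have b0 : 0 < b by rewrite divr_gt0// mulr_gt0// exprn_gt0.
have e40 : 0 < 4 * e * e by rewrite !mulr_gt0.
pose A1 := 8 * c ^+ 2 * f0 * B / (1 - c).
pose A2 := (2 / a + 2 / b) / (4 * e * e).
have A10 : 0 <= A1.
  by rewrite divr_ge0 ?mulr_ge0 ?sqr_ge0 ?(ltW f00)//; lra.
have A20 : 0 <= A2.
  by rewrite divr_ge0 ?(ltW e40)// addr_ge0// divr_ge0// ltW.
exists (3 + A1 + A2) => n lam lam0; set X := n%:R * lam => AL AX L M N T r'.
have [L3 A2L] : 3 <= L /\ A2 <= L by move: AL A10 A20; rewrite -/L; clear; lra.
have [X1 A1X] : 1 <= X /\ A1 <= X by move: AX A10 A20; clear; lra.
have L0 : 0 < L by apply: lt_le_trans L3.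
have [M0 N0 N2] := block_count lam0 L3 X1; split=> //.
  have X0 : 0 < X by apply: lt_le_trans X1.
  have /andP[M1 _] := truncn_itv (ltW X0); rewrite -/M in M1.
  apply: (@le_trans _ _ (c ^+ 2 * (2 * f0 * L / X) * ((c * f0)^-1 * X + 4 * B))).
    rewrite ler_wpM2l//; first by rewrite !mulr_ge0 ?invr_ge0 ?sqr_ge0// ltW.
    by rewrite lerD2r ler_wpM2l// invr_ge0 ltW// mulr_gt0.
  have -> : c ^+ 2 * (2 * f0 * L / X) * ((c * f0)^-1 * X + 4 * B) =
      L * (2 * c + (8 * c ^+ 2 * f0 * B) / X).
    by field; rewrite !gt_eqF.
  rewrite /T mulrC ler_pM2r//.
  have : 8 * c ^+ 2 * f0 * B / X <= 1 - c.
    by rewrite ler_pdivrMr// [leRHS]mulrC -ler_pdivrMr ?subr_gt0.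
  by clear; lra.
have h1 : expR (T * (2^-1 + r')) / N%:R <= 2 * expR (- (a * L)).
  rewrite ler_pdivrMr ?ltr0n//.
  apply: (@le_trans _ _ (2 * expR (- (a * L)) * (2 * lam)^-1)); last first.
    by rewrite ler_wpM2l// mulr_ge0// expR_ge0.
  have -> : (2 * lam)^-1 = 2^-1 * expR L by rewrite invfM /L expRN lnK.
  rewrite mulrACA mulfV// mul1r -expRD ler_expR /T /r' /a.
  by rewrite le_eqVlt; apply/orP; left; apply/eqP; field; rewrite gt_eqF.
have h2 : - (r' ^+ 2 * T / 2) = - (b * L).
  by rewrite /b /T /r' -/r; field.
rewrite h2 ler_pdivrMr ?mulr_gt0//.
apply: (@le_trans _ _ (2 * (a * L)^-1 + 2 * (b * L)^-1)).
  apply: lerD.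
    by apply: (le_trans h1); rewrite ler_wpM2l// expRN_le// mulr_gt0.
  by rewrite ler_wpM2l// expRN_le// mulr_gt0.
have -> : 2 * (a * L)^-1 + 2 * (b * L)^-1 = (2 / a + 2 / b) / L.
  by field; rewrite !gt_eqF.
rewrite ler_pdivrMr//.
have -> : e * (4 * e) * L = L * (4 * e * e) by ring.
by rewrite -ler_pdivrMr.
Qed.

(** The supremum defining the type II error is at least the average over disjoint
    blocks, and the mixture of these alternatives is close to the null
    hypothesis. *)
Lemma no_test_detects (lambda : nat -> R) (f : R -> R) (m M : R)
    (Sigma : forall n, 'M[R]_n)
    (lambda01 : forall n, (1 <= n)%N -> 0 < lambda n < 1)
    (lambda_lower : n%:R * lambda n / ln n%:R @[n --> \oo] --> +oo)
    (lambda_upper : lambda =o_\oo (fun n : nat => 1 / ln n%:R))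
    (f_cont : {within `[- 2^-1, 2^-1[, continuous f})
    (m_gt0 : 0 < m) (f_ge : forall u, freq_dom u -> m <= f u)
    (f_le : forall u, freq_dom u -> f u <= M)
    (SigmaE : forall n, toeplitz_of f (Sigma n))
    (Sigma_cov : forall n, (1 <= n)%N -> is_covariance_mx (Sigma n))
    (alpha c : R) (c01 : 0 < c < 1) (Phi : forall n, test R n) :
  asymptotic_level Phi Sigma alpha ->
  ((1 - alpha)%:E
       <= limn_einf (fun n => type2_error (Phi n) (Sigma n)
                       (c * detection_rate f lambda n) (lambda n)))%E.
Proof.
move=> level; have /andP[c0 c1] := c01.
have bf := bounded_mfun_spectral_density f_cont f_ge f_le.
have f00 : 0 < f 0 := lt_le_trans m_gt0 (f_ge 0 freq_dom0).
have cf0 : 0 < c * f 0 by rewrite mulr_gt0.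
have cf : c * f 0 < f 0 by rewrite gtr_pMl.
have [B B0 fB] := inv_spectral_density_majorant f_cont m_gt0 f_ge cf0 cf.
apply/lee_addgt0Pr => e e0; rewrite -leeBlDr// -EFinB.
apply: limn_einf_ge_near.
have e4 : 0 < e / 4 by rewrite divr_gt0.
have [A AP] := prior_slack c01 f00 B0 e4.
have scale := scale_asymptotics lambda01 lambda_lower lambda_upper (Num.max A 1).
have level_n := limn_esup_near_le level e4.
near=> n.
have [n1] : [/\ (0 < n)%N, Num.max A 1 <= - ln (lambda n) &
    Num.max A 1 <= n%:R * lambda n] by near: n.
rewrite !ge_max => /andP[AL L1] /andP[AX X1].
have t1 : (type1_error (Phi n) (Sigma n) <= (alpha + e / 4)%:E)%E by near: n.
have /andP[lam0 lam1] := lambda01 n n1; have cS := Sigma_cov n n1.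
have [M0 N0 TP errP] := AP n (lambda n) lam0 AL AX.
move: M0 N0 TP errP.
set w := Num.truncn _; set N := (_ %/ w)%N; set T := (1 + c) * _; set r := (1 - c) / _.
move=> M0 N0 TP errP.
have L0 : 0 < - ln (lambda n) by rewrite (lt_le_trans _ L1).
have T0 : 0 <= T by rewrite mulr_ge0 ?addr_ge0// ltW.
have uA : mx_root (Sigma n) \in unitmx.
  apply: (mx_root_unit cS m_gt0) => v.
  exact: quad_lower_bound bf f_ge (SigmaE n).
pose delta := c * detection_rate f lambda n.
have delta0 : 0 <= delta by rewrite mulr_ge0 ?sqrtr_ge0// ltW.
have delta2 : delta ^+ 2 = c ^+ 2 * (2 * f 0 * - ln (lambda n) / (n%:R * lambda n)).
  rewrite exprMn sqr_sqrtr; last first.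
    rewrite divr_ge0//; last by rewrite (le_trans _ X1).
    by rewrite mulNr mulNr -mulrN !mulr_ge0// ltW.
  by congr (_ * (_ / _)); ring.
have NMn : (N * w <= n)%N by rewrite (leq_trans (leq_divM _ _))// leq_pred.
have kMn (k : 'I_N) : (k.+1 * w < n)%N.
  rewrite -[ltnRHS](prednK n1) ltnS; apply: (@leq_trans (N * w)).
    by rewrite leq_mul2r ltn_ord orbT.
  exact: leq_divM.
pose th (k : 'I_N) : 'I_n -> R := whitened_block (Sigma n) delta w k.
have thT x : dot (combine x th) (combine x th) <= T * dot x x.
  apply: (le_trans (whitened_gram_le delta x bf (SigmaE n) cS m_gt0 f_ge B0 fB M0 NMn uA)).
  rewrite ler_wpM2r//; first by apply: sumr_ge0 => k _; rewrite -expr2 sqr_ge0.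
  by rewrite delta2.
have [rs rsP] := gram_completion thT.
have mPhi b := measurable_test (Phi n) b.
pose acc := affine_map 0 (mx_root (Sigma n)) @^-1` [set y | Phi n y = false].
have macc : measurable acc.
  have := measurable_affine_map 0 (mx_root (Sigma n)) measurableT (mPhi false).
  by rewrite setTI.
have r01 : 0 <= r <= 1.
  have p0 : 0 < 4 * (1 + c) by rewrite mulr_gt0// addr_gt0.
  rewrite /r divr_ge0 ?subr_ge0 ?(ltW c1) ?(ltW p0)//= ler_pdivrMr// mul1r.
  by move: c0; clear; lra.
rewrite leNgt; apply/negP => t2.
have pk (k : 'I_N) :
    fine (std_gaussian n (shift_tuple (th k) @^-1` acc)) <= 1 - alpha - e.
  have [I Ilam IE] := block_interval n1 lam0 (kMn k).
  have pE : std_gaussian n (shift_tuple (th k) @^-1` acc) =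
      gaussian_law (delta *: indic_vec n I) (Sigma n) [set y | Phi n y = false].
    by rewrite gaussian_law_shift// IE.
  rewrite -lee_fin fineK ?fin_num_measure//; last first.
    by have := measurable_shift_tuple (th k) measurableT macc; rewrite setTI.
  rewrite pE; apply: le_trans (ltW t2).
  apply: ereal_sup_ubound; exists I, delta; split=> //.
  by rewrite ger0_norm.
have bound := mixture_test_bound N0 r01 T0 e4 macc rsP pk.
have accE : fine (std_gaussian n acc) = 1 - fine (type1_error (Phi n) (Sigma n)).
  have -> : std_gaussian n acc = gaussian_law 0 (Sigma n) [set y | Phi n y = false] by [].
  have -> : [set y | Phi n y = false] = ~` [set y | Phi n y = true].
    by apply/seteqP; split => y /=; [move=> ->|move/negP/negbTE].
  rewrite (probability_setC _ (mPhi true)).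
  by rewrite fineB ?fin_num_measure//; exact: (mPhi true).
have t1' : fine (type1_error (Phi n) (Sigma n)) <= alpha + e / 4.
  by rewrite -lee_fin fineK// fin_num_measure//; exact: (mPhi true).
move: bound errP t1' e0; rewrite accE; set t := fine _; set err := _ / (4 * _).
by clearbody t err; clear; lra.
Unshelve. all: by end_near. Qed.

End lower_bound.

(** * The detection boundary *)

Unset Implicit Arguments.
Local Open Scope complex_scope.

Theorem theorem2p1 (R : realType) (lambda : nat -> R) (f : R -> R)
    (C kappa : R) (Sigma : forall n, 'M[R]_n)
    (lambda01 : forall n, (1 <= n)%N -> 0 < lambda n < 1)
    (lambda_lower : n%:R * lambda n / ln n%:R @[n --> \oo] --> +oo)
    (lambda_upper : lambda =o_\oo (fun n : nat => 1 / ln n%:R))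
    (f_cont : {within `[- 2^-1, 2^-1[, continuous f})
    (f_per : f nu @[nu --> 2^-1^'-] --> f (- 2^-1))
    (f_pos : (0 < freq_ess_inf f)%E)
    (C_gt0 : 0 < C) (kappa_gt0 : 0 < kappa)
    (f_decay : forall h : int,
      `|fourier_coef f h| <= (C * (1 + `|h|%:~R) `^ (- (1 + kappa)))%:C)
    (SigmaE : forall n (i j : 'I_n),
      (Sigma n i j)%:C = fourier_coef f (j%:Z - i%:Z))
    (Sigma_cov : forall n, (1 <= n)%N -> is_covariance_mx (Sigma n))
    (alpha : R) (alpha_range : 0 < alpha < 2^-1) :
  (exists Phi : forall n, test R n,
      asymptotic_level Phi Sigma alpha /\
      forall c : R, 1 < c ->
        (limn_esup (fun n => type2_error (Phi n) (Sigma n)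
                      (c * detection_rate f lambda n) (lambda n))
         <= alpha%:E)%E) /\
  (forall c : R, 0 < c < 1 ->
    forall Phi : forall n, test R n, asymptotic_level Phi Sigma alpha ->
      ((1 - alpha)%:E
       <= limn_einf (fun n => type2_error (Phi n) (Sigma n)
                       (c * detection_rate f lambda n) (lambda n)))%E).
Proof.
have [m m_gt0 f_ge] := freq_ess_inf_lower_bound f_cont f_pos.
have [M f_le] := spectral_density_upper_bound f_cont f_per.
have toeplitz n : toeplitz_of f (Sigma n).
  exact: toeplitz_of_fourier_coef (SigmaE n).
split.
  apply: (scan_detects lambda01 lambda_lower lambda_upper f_cont m_gt0 f_ge f_le
    toeplitz Sigma_cov).
  by case/andP: alpha_range => -> /= h; apply: (lt_trans h); lra.
move=> c c01 Phi level.
exact: (no_test_detects lambda01 lambda_lower lambda_upper f_cont m_gt0 f_ge f_le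
  toeplitz Sigma_cov c01 level).
Qed.
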